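(* Let $\Bbbk$ be a field, $V$ a finite-dimensional $\Bbbk$-vector space and $R$ a Hecke symmetry on $V$ with parameter $q$. Let $n>0$. If $\dim\Upsilon^{(n)}=1$ and $\Upsilon^{(n+1)}=0$, then the algebras $\Upsilon(V,R)$ and $\mathbb{S}(V,R)^!$ are Frobenius. Moreover, if $\dim V>1$, then $\dim\Upsilon^{(n)}=1$ already implies $\Upsilon^{(n+1)}=0$.
   Context: A Hecke symmetry on $V$ with parameter $0\neq q\in\Bbbk$ is a linear map $R:V\otimes V\to V\otimes V$ satisfying $(R\otimes\mathrm{Id}_V)(\mathrm{Id}_V\otimes R)(R\otimes\mathrm{Id}_V)=(\mathrm{Id}_V\otimes R)(R\otimes\mathrm{Id}_V)(\mathrm{Id}_V\otimes R)$ and $(R-q\,\mathrm{Id})(R+\mathrm{Id})=0$ ($q=-1$ allowed). In $\mathbb{T}(V)$ products of homogeneous elements are written $ab=a\otimes b$. For $p\ge2$, $1\le i\le p-1$, $R_i^{(p)}=\mathrm{Id}_V^{\otimes(i-1)}\otimes R\otimes\mathrm{Id}_V^{\otimes(p-i-1)}$ on $V^{\otimes p}$. $\Upsilon^{(0)}=\Bbbk$, $\Upsilon^{(1)}=V$, $\Upsilon^{(p)}=\bigcap_{i=1}^{p-1}(R_i^{(p)}-q\,\mathrm{Id})V^{\otimes p}$ for $p\ge 2$. Hecke algebra ${\cal H}_m$: generators $T_1,\dots,T_{m-1}$, relations $T_iT_jT_i=T_jT_iT_j$ ($|i-j|=1$), $T_iT_j=T_jT_i$ ($|i-j|>1$),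 $(T_i-q)(T_i+1)=0$; basis $T_\sigma$, $\sigma\in S_m$, $T_\sigma=T_{i_1}\cdots T_{i_r}$ for a reduced expression $\sigma=\tau_{i_1}\cdots\tau_{i_r}$, $\tau_i=(i,i+1)$, $\ell$ the length function. ${\cal H}_m$ acts on $V^{\otimes p}$, $p\ge m$, with $T_i\mapsto R_i^{(p)}$. For $0\le k\le m$, $D_{k,m-k}$ is the set of $\sigma\in S_m$ increasing on $\{1,\dots,k\}$ and on $\{k+1,\dots,m\}$, and $y_{m/k,m-k}=\sum_{d\in D_{k,m-k}}(-1)^{\ell(d)}q^{k(m-k)-\ell(d)}T_d$. $\Upsilon(V,R)=\bigoplus_{k\ge0}\Upsilon^{(k)}$ is the graded associative unital algebra with product $a\star b=y_{k+l/k,l}(ab)$ for $a\in\Upsilon^{(k)},b\in\Upsilon^{(l)}$. $\mathbb{S}(V,R)^!$ is the quotient of $\mathbb{T}(V^* )$ by the ideal generated by $(\Upsilon^{(2)})^\perp\subset V^*\otimes V^*$, with respect to the pairing $\langle f\otimes g,v\otimes w\rangle=f(v)g(w)$. *)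

(* Defs.v *)
(* V = K^d in a fixed basis e_0,...,e_{d-1}. *)
From HB Require Import structures.
From mathcomp Require Import all_boot all_order all_fingroup all_algebra.
Set Implicit Arguments. Unset Strict Implicit. Unset Printing Implicit Defensive.
Import Order.TTheory GRing.Theory.
Local Open Scope ring_scope.

Section Hecke.
Variables (K : fieldType) (d : nat).

(* An element of the tensor algebra T(V) (or of V^{** p}) is given by its
   coordinates: t w is the coefficient of e_{w_0} (x) ... (x) e_{w_{p-1}}.
   Homogeneous elements of degree p are supported on words of size p. *)
Definition tens := seq 'I_d -> K.

Definition tzero : tens := fun _ => 0.
Definition tlin (x : K) (f : tens) (y : K) (g : tens) : tens :=
  fun w => x * f w + y * g w.

(* finitely supported = element of the (direct-sum) tensor algebra *)
Definition fsupp (f : tens) := exists N, forall w, (N <= size w)%N -> f w = 0.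

Definition comp (k : nat) (f : tens) : tens :=
  fun w => if size w == k then f w else 0.

Definition homog (p : nat) (f : tens) := forall w, size w != p -> f w = 0.

Definition tmul (f g : tens) : tens :=
  fun w => \sum_(i < (size w).+1) f (take i w) * g (drop i w).

Variable Rc : 'I_d -> 'I_d -> 'I_d -> 'I_d -> K.
(* R (e_a (x) e_b) = \sum_{c,e} Rc c e a b  e_c (x) e_e *)

(* Rop j acts as Id^{j} (x) R (x) Id on the positions j, j+1 (0-indexed) of
   words of size > j+1, i.e. Rop j = R_{j+1}^{(p)} on V^{** p}. *)
Definition Rop (j : nat) (f : tens) : tens := fun w =>
  match w with
  | [::] => f w
  | x :: _ =>
    if (j.+1 < size w)%N then
      \sum_(a : 'I_d) \sum_(b : 'I_d)
        Rc (nth x w j) (nth x w j.+1) a b * f (set_nth x (set_nth x w j a) j.+1 b)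
    else f w
  end.

Variable q : K.

Definition hecke :=
  q != 0 /\
  (forall f w, size w = 3%N ->
     Rop 0 (Rop 1 (Rop 0 f)) w = Rop 1 (Rop 0 (Rop 1 f)) w) /\
  (forall f w, size w = 2%N ->
     Rop 0 (Rop 0 f) w - q * Rop 0 f w + Rop 0 f w - q * f w = 0).

Definition Ups (p : nat) (f : tens) :=
  homog p f /\
  forall j, (j.+1 < p)%N ->
    exists g, homog p g /\ forall w, f w = Rop j g w - q * g w.

Definition dim1 (P : tens -> Prop) :=
  exists f0, [/\ P f0, exists w, f0 w != 0 &
                 forall f, P f -> exists c : K, forall w, f w = c * f0 w].
Definition tnull (f : tens) := forall w, f w = 0.
Definition zero_sp (P : tens -> Prop) := forall f, P f -> forall w, f w = 0.

Definition tau (m j : nat) : 'S_m :=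
  match (j.+1 < m)%N as b return (j.+1 < m)%N = b -> 'S_m with
  | true => fun h => tperm (Ordinal (ltnW h)) (Ordinal h)
  | false => fun _ => 1%g
  end erefl.

(* word_perm m [:: i1; ...; ir] = tau_{i1} o ... o tau_{ir} *)
Definition word_perm (m : nat) (s : seq nat) : 'S_m :=
  foldr (fun j p => (p * tau m j)%g) 1%g s.

Definition len (m : nat) (s : 'S_m) : nat :=
  #|[pred p : 'I_m * 'I_m | (p.1 < p.2)%N && (s p.2 < s p.1)%N]|.

Definition reduced_word (m : nat) (s : 'S_m) : option (seq nat) :=
  omap (fun t : (len s).-tuple 'I_m => map val t)
    [pick t : (len s).-tuple 'I_m |
       all (fun j : 'I_m => (j.+1 < m)%N) t && (word_perm m (map val t) == s)].

(* action of T_s = T_{i1} ... T_{ir} with T_i |-> R_i *)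
Definition Tact (m : nat) (s : 'S_m) (f : tens) : tens :=
  match reduced_word s with
  | Some ws => foldr (fun j g => Rop j g) f ws
  | None => f
  end.

Definition shuffle (m k : nat) (s : 'S_m) : bool :=
  [forall i : 'I_m, forall j : 'I_m,
     ((i < j)%N && ((j < k)%N || (k <= i)%N)) ==> (s i < s j)%N].

Definition yop (m k : nat) (f : tens) : tens := fun w =>
  \sum_(s : 'S_m | shuffle k s)
     (-1) ^+ len s * q ^+ (k * (m - k) - len s)%N * Tact s f w.

(* star product on Upsilon(V,R), extended bilinearly from
   a * b = y_{k+l/k,l}(ab) for a in Ups^(k), b in Ups^(l) *)
Definition star (f g : tens) : tens := fun w =>
  \sum_(k < (size w).+1)
     yop (size w) k (tmul (comp k f) (comp (size w - k)%N g)) w.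

Definition A_Ups (f : tens) := fsupp f /\ forall k, Ups k (comp k f).

(* (Ups^(2))^perp in V* (x) V*, elements of T(V* ) written in the dual basis *)
Definition perp2 (phi : tens) :=
  homog 2 phi /\
  forall x, Ups 2 x ->
    \sum_(a : 'I_d) \sum_(b : 'I_d) phi [:: a; b] * x [:: a; b] = 0.

End Hecke.

Section Frob.
Variables (K : fieldType) (d : nat).
Local Notation tens := (tens K d).

Definition ideal (G : tens -> Prop) (f : tens) :=
  forall P : tens -> Prop,
    P (@tzero K d) ->
    (forall g h x y, P g -> P h -> P (tlin x g y h)) ->
    (forall g, G g -> P g) ->
    (forall g x, P g -> fsupp x -> P (tmul x g) /\ P (tmul g x)) ->
    P f.

(* The algebra A / I (A a subspace of tens, I a subspace/ideal of A, product
   mul) is Frobenius: finite dimensional and carrying a nondegenerate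
   associative bilinear form. *)
Definition frobenius (A I : tens -> Prop) (mul : tens -> tens -> tens) :=
  (exists (r : nat) (e : 'I_r -> tens), (forall i, A (e i)) /\
     forall f, A f -> exists c : 'I_r -> K,
       I (fun w => f w - \sum_(i < r) c i * e i w)) /\
  exists B : tens -> tens -> K,
    [/\ (forall a b c x y, A a -> A b -> A c ->
           B (tlin x a y b) c = x * B a c + y * B b c /\
           B c (tlin x a y b) = x * B c a + y * B c b),
        (forall a b, A a -> A b -> I a -> B a b = 0 /\ B b a = 0),
        (forall a b c, A a -> A b -> A c -> B (mul a b) c = B a (mul b c)),
        (forall a, A a -> ~ I a -> exists b, A b /\ B a b != 0) &
        (forall a, A a -> ~ I a -> exists b, A b /\ B b a != 0)].

End Frob.

(* Main.v *)
Require Import Defs.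
From Stdlib Require Import FunctionalExtensionality.
From mathcomp Require Import all_boot all_order all_fingroup all_algebra.
From mathcomp Require Import zify ring.
Set Implicit Arguments. Unset Strict Implicit. Unset Printing Implicit Defensive.
Import GRing.Theory.
Local Open Scope ring_scope.

(* Contracting with a generator [om] of Ups(n) pairs Ups(k) with Ups(n-k).  Nondegeneracy
   comes from Ups(n+1) = 0: for [x] in Ups(k) the star products of degree above [n] of
   tails of [om] with initial parts of [x] vanish, and expanding them by the recursion of
   the q-shuffle operators gives, by induction on [k], that applying the star product to
   the last [n] factors of [om (x) x] is, up to a nonzero scalar, the same as braiding
   [om] past [x].  As the braiding is invertible and [om] spans Ups(n), this shows both
   that b * x <> 0 for some [b] in Ups(n-k) when [x <> 0], and that every element of
   Ups(k) is a contraction of [om]; the latter is nondegeneracy for the quadratic dual,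
   whose component of degree [k] is the dual of Ups(k). *)

(** * The braiding operators on tensors *)

(** The q-factorials may vanish, so no projection onto Ups(k) can be obtained by normalising an
    antisymmetrizer, and for [q = -1] the image of R - q can be strictly smaller than the kernel of
    R + 1. The argument therefore works with membership in images ([Im]), where R acts by -1, and
    the only scalars built from [q] that it inverts are powers of [q] and signs. The recursion
    removes factors from the left only, which yields nondegeneracy in one argument of each form: the
    right argument for the star product, the left one for the quadratic dual. The other side comes
    from finite dimension, through a square Gram matrix. Since [star] is defined by a sum over
    shuffles acting through arbitrarily picked reduced words, it must first be matched with the
    recursive operators; the link is the encoding of a shuffle by a word of bits. *)

Section Operators.
Variables (K : fieldType) (d : nat) (Rc : 'I_d -> 'I_d -> 'I_d -> 'I_d -> K) (q : K).
Local Notation tens := (tens K d).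
Implicit Types (f g h : tens) (u v w : seq 'I_d).

(** Cutting the word at the active positions removes the default letters of [nth] and [set_nth];
    later computations use only this form. *)
Lemma Rop_cat f u a b v :
  Rop Rc (size u) f (u ++ a :: b :: v) =
  \sum_(x : 'I_d) \sum_(y : 'I_d) Rc a b x y * f (u ++ x :: y :: v).
Proof.
have -> : Rop Rc (size u) f (u ++ a :: b :: v) =
    \sum_(x : 'I_d) \sum_(y : 'I_d)
      Rc (nth a (u ++ a :: b :: v) (size u)) (nth a (u ++ a :: b :: v) (size u).+1) x y *
      f (set_nth a (set_nth a (u ++ a :: b :: v) (size u) x) (size u).+1 y).
  have h : ((size u).+1 < size (u ++ a :: b :: v))%N by rewrite size_cat /=; lia.
  case E : (u ++ a :: b :: v) h => [|c s] h; first by case: (u) E.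
  rewrite /Rop h; apply: eq_bigr => x _; apply: eq_bigr => y _.
  rewrite (set_nth_default a) ?(set_nth_default a _ h) //; last by apply: ltnW.
  congr (_ * f _).
  have eq_set s1 i z (c1 c2 : 'I_d) : (i < size s1)%N -> set_nth c1 s1 i z = set_nth c2 s1 i z.
    elim: s1 i => [|e s1 IH] [|i] //= hi; by rewrite (IH i).
  rewrite (eq_set _ _ _ c a); last by rewrite size_set_nth; lia.
  by rewrite (eq_set _ _ _ c a) //; apply: ltnW.
apply: eq_bigr => x _; apply: eq_bigr => y _; congr (Rc _ _ _ _ * f _).
- by rewrite nth_cat ltnn subnn.
- by rewrite nth_cat ltnNge leqnSn /= subSn // subnn.
- by elim: u => //= c u ->.
Qed.

Lemma word_split j w : (j.+1 < size w)%N ->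
  exists u a b v, w = u ++ a :: b :: v /\ size u = j.
Proof.
move=> h; exists (take j w).
have hs : (1 < size (drop j w))%N by rewrite size_drop; lia.
case E : (drop j w) hs => [|a [|b v]] // _.
exists a, b, v; split; last by rewrite size_takel //; lia.
by rewrite -E cat_take_drop.
Qed.

(* Acting by [q] on words of size other than [p] keeps the Hecke relation valid there and
   makes every element of the image of [braid_op p j - q] homogeneous of degree [p]. *)
Definition braid_op (p j : nat) f : tens :=
  fun w => if size w == p then Rop Rc j f w else q * f w.
Local Notation r := braid_op.

Lemma braid_op_cat p f u a b v : size (u ++ a :: b :: v) = p ->
  r p (size u) f (u ++ a :: b :: v) =
  \sum_(x : 'I_d) \sum_(y : 'I_d) Rc a b x y * f (u ++ x :: y :: v).
Proof. by move=> hp; rewrite /r hp eqxx Rop_cat. Qed.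

Lemma braid_op_off p j f w : size w != p -> r p j f w = q * f w.
Proof. by rewrite /r => /negbTE->. Qed.

Lemma tens_ext p (f g : tens) :
  (forall w, size w = p -> f w = g w) -> (forall w, size w != p -> f w = g w) -> f = g.
Proof.
by move=> h1 h2; apply: functional_extensionality => w; have [/h1|/h2] := eqVneq (size w) p.
Qed.

Lemma braid_op_lin p j x f y g : (j.+1 < p)%N ->
  r p j (tlin x f y g) = tlin x (r p j f) y (r p j g).
Proof.
move=> hj; apply: (@tens_ext p) => w hw; last by rewrite /tlin !braid_op_off //; ring.
have /word_split[u [a [b [v [ew su]]]]] : (j.+1 < size w)%N by rewrite hw.
subst j w; rewrite /tlin !braid_op_cat // !mulr_sumr -big_split /=; apply: eq_bigr => s _.
rewrite !mulr_sumr -big_split /=; apply: eq_bigr => t _; ring.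
Qed.

(** Contraction of the leading factors with the dual basis tensor of [u]; [ctrr] does the same with
    the trailing factors. *)
Definition ctr u f : tens := fun w => f (u ++ w).
Definition ctrr v f : tens := fun w => f (w ++ v).

Lemma ctr_braid_op u p j f : (j.+1 < p)%N ->
  ctr u (r (size u + p) (size u + j) f) = r p j (ctr u f).
Proof.
move=> hj; apply: (@tens_ext p) => w hw.
  have /word_split[s [a [b [v [ew su]]]]] : (j.+1 < size w)%N by rewrite hw.
  subst j w; rewrite /ctr catA -size_cat !braid_op_cat -?catA ?size_cat -?hw //.
    by do 2 (apply: eq_bigr => ? _); rewrite -catA.
    by rewrite size_cat.
  by rewrite size_cat.
by rewrite /ctr !braid_op_off // size_cat eqn_add2l.
Qed.

Lemma ctrr_braid_op v p j f : (j.+1 < p)%N ->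
  ctrr v (r (p + size v) j f) = r p j (ctrr v f).
Proof.
move=> hj; apply: (@tens_ext p) => w hw.
  have /word_split[s [a [b [t [ew su]]]]] : (j.+1 < size w)%N by rewrite hw.
  subst j w; rewrite /ctrr -catA !braid_op_cat // -?hw ?size_cat /= ?size_cat; last by lia.
  by do 2 (apply: eq_bigr => ? _); rewrite -catA.
by rewrite /ctrr !braid_op_off // size_cat eqn_add2r.
Qed.

Lemma exchange_sum4 (I : finType) (F : I -> I -> I -> I -> K) :
  \sum_x \sum_y \sum_s \sum_t F x y s t = \sum_s \sum_t \sum_x \sum_y F x y s t.
Proof.
transitivity (\sum_x \sum_s \sum_y \sum_t F x y s t).
  by apply: eq_bigr => x _; rewrite exchange_big.
rewrite exchange_big; apply: eq_bigr => s _ /=.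
transitivity (\sum_x \sum_t \sum_y F x y s t).
  by apply: eq_bigr => x _; rewrite exchange_big.
by rewrite exchange_big.
Qed.

Lemma braid_op_comm p i j f : (i.+1 < j)%N -> (j.+1 < p)%N ->
  r p i (r p j f) = r p j (r p i f).
Proof.
move=> hij hj; apply: (@tens_ext p) => w hw; last by rewrite !braid_op_off.
have /word_split[u [a [b [v [ew su]]]]] : (i.+1 < size w)%N by rewrite hw; lia.
have /word_split[v1 [a' [b' [v2 [ev sv]]]]] : ((j - i.+2).+1 < size v)%N.
  by move: hw; rewrite ew size_cat /=; lia.
subst w v i.
have rj x y g : r p j g (u ++ x :: y :: v1 ++ a' :: b' :: v2) =
    \sum_s \sum_t Rc a' b' s t * g (u ++ x :: y :: v1 ++ s :: t :: v2).
  have -> : j = size (u ++ x :: y :: v1) by rewrite size_cat /= sv; lia.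
  rewrite -2!cat_cons catA braid_op_cat.
    by do 2 (apply: eq_bigr => ? _); rewrite -catA.
  by rewrite -hw; do ?rewrite size_cat /=; lia.
rewrite rj braid_op_cat //.
under eq_bigr => x _ do under eq_bigr => y _ do rewrite rj.
under [RHS]eq_bigr => s _ do under eq_bigr => t _ do
  (rewrite braid_op_cat; last by rewrite -hw; do ?rewrite size_cat /=; lia).
transitivity (\sum_x \sum_y \sum_s \sum_t Rc a b x y * (Rc a' b' s t * f (u ++ x :: y :: v1 ++ s :: t :: v2))).
  do 2 (apply: eq_bigr => ? _); rewrite mulr_sumr; apply: eq_bigr => ? _.
  by rewrite mulr_sumr; apply: eq_bigr => ? _.
rewrite exchange_sum4; do 2 (apply: eq_bigr => ? _); rewrite mulr_sumr; apply: eq_bigr => ? _.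
by rewrite mulr_sumr; apply: eq_bigr => ? _; rewrite mulrCA.
Qed.

Lemma Rop_ext j f g w : (forall w', size w' = size w -> f w' = g w') ->
  Rop Rc j f w = Rop Rc j g w.
Proof.
move=> h; case: (ltnP j.+1 (size w)) => hj.
  have [u [a [b [v [ew su]]]]] := word_split hj; subst j w.
  rewrite !Rop_cat; do 2 (apply: eq_bigr => ? _); rewrite h //.
  by rewrite !size_cat.
by case: w h hj => [|x w] h; rewrite /Rop ?h // ltnNge => ->.
Qed.

Lemma Rop_inner f u v w j : (j.+1 < size w)%N ->
  Rop Rc (size u + j) f (u ++ w ++ v) = Rop Rc j (fun z => f (u ++ z ++ v)) w.
Proof.
move=> /word_split[s [a [b [t [-> <-]]]]].
rewrite -catA /= catA -size_cat !Rop_cat; do 2 (apply: eq_bigr => ? _).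
by rewrite -!catA.
Qed.

Lemma word_inner k j w : (j + k <= size w)%N ->
  exists u s v, [/\ w = u ++ s ++ v, size u = j & size s = k].
Proof.
move=> h; exists (take j w), (take k (drop j w)), (drop k (drop j w)); split.
- by rewrite !cat_take_drop.
- by rewrite size_takel //; lia.
- by rewrite size_takel // size_drop; lia.
Qed.

Hypothesis heckeR : hecke Rc q.

Lemma q_neq0 : q != 0. Proof. by case: heckeR. Qed.

Lemma braid_op_braid p j f : (j.+2 < p)%N ->
  r p j (r p j.+1 (r p j f)) = r p j.+1 (r p j (r p j.+1 f)).
Proof.
move=> hj; apply: (@tens_ext p) => w hw; last by rewrite !braid_op_off.
have [u [s [v [ew su ss]]]] : exists u s v, [/\ w = u ++ s ++ v, size u = j & size s = 3].
  by apply: word_inner; lia.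
(* With the outer letters [u] and [v] frozen, the operators act on words of size 3, where [hecke]
   states the braid relation. *)
have inner i g z : (i < 2)%N -> size z = 3 ->
    r p (j + i) g (u ++ z ++ v) = Rop Rc i (fun z => g (u ++ z ++ v)) z.
  move=> hi sz; rewrite /r ifT ?Rop_inner -?su ?Rop_inner ?sz //.
  by apply/eqP; rewrite -hw ew !size_cat ss sz.
have /(_ 0) inner0 := inner; have /(_ 1) inner1 := inner.
rewrite addn0 in inner0; rewrite addn1 in inner1.
have loc_ext i g h z : size z = 3 -> (forall z, size z = 3 -> g z = h z) -> Rop Rc i g z = Rop Rc i h z.
  by move=> sz gh; apply: Rop_ext => z'; rewrite sz; apply: gh.
rewrite ew inner0 //; rewrite (loc_ext 0 _ _ s ss (fun z sz => inner1 _ z _ sz)) //.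
transitivity (Rop Rc 0 (Rop Rc 1 (Rop Rc 0 (fun z => f (u ++ z ++ v)))) s).
  by apply: (loc_ext) => // z sz; apply: (loc_ext) => // z' sz'; rewrite inner0.
case: heckeR => _ [-> // _].
rewrite inner1 //; apply: (loc_ext) => // z sz; rewrite inner0 //; apply: (loc_ext) => // z' sz'.
by rewrite inner1.
Qed.

Lemma braid_op_quad p j f : (j.+1 < p)%N ->
  r p j (r p j f) = tlin (q - 1) (r p j f) q f.
Proof.
move=> hj; apply: (@tens_ext p) => w hw; last by rewrite /tlin !braid_op_off //; ring.
have [u [s [v [ew su ss]]]] : exists u s v, [/\ w = u ++ s ++ v, size u = j & size s = 2].
  by apply: word_inner; lia.
have inner g z : size z = 2 ->
    r p j g (u ++ z ++ v) = Rop Rc 0 (fun z => g (u ++ z ++ v)) z.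
  move=> sz; rewrite /r ifT; first by rewrite -[j]addn0 -su Rop_inner ?sz.
  by apply/eqP; rewrite -hw ew !size_cat ss sz.
rewrite /tlin ew inner // -[LHS]subr0.
case: heckeR => _ [_ /(_ (fun z => f (u ++ z ++ v)) s ss) <-].
rewrite inner //; rewrite (@Rop_ext _ _ (Rop Rc 0 (fun z => f (u ++ z ++ v)))); first by ring.
by move=> z; rewrite ss => sz; rewrite inner.
Qed.

(** Solving R^2 = (q - 1) R + q for the inverse of R. *)
Definition braid_inv (p j : nat) f : tens := tlin q^-1 (r p j f) (q^-1 - 1) f.

Lemma braid_opK p j f : (j.+1 < p)%N -> braid_inv p j (r p j f) = f.
Proof.
move=> hj; rewrite /braid_inv braid_op_quad //; apply: functional_extensionality => w.
by rewrite /tlin; field; exact: q_neq0.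
Qed.

Lemma braid_invK p j f : (j.+1 < p)%N -> r p j (braid_inv p j f) = f.
Proof. by move=> hj; rewrite braid_op_lin // -[RHS](@braid_opK p j). Qed.

End Operators.

(** * q-shuffle operators *)

Section Shuffles.
Variables (K : fieldType) (d : nat) (Rc : 'I_d -> 'I_d -> 'I_d -> 'I_d -> K) (q : K).
Local Notation tens := (tens K d).
Local Notation r := (braid_op Rc q).
Implicit Types (f g h : tens) (u v w : seq 'I_d) (F : tens -> tens).

Definition linear_op F := forall x f y g, F (tlin x f y g) = tlin x (F f) y (F g).

(* On V^{** p}, with 0-indexed generators: [chain p i k] is R_i ... R_(i+k-1);
   [shuf p k l i] is y_{k+l/k,l} acting on the tensor factors i, ..., i+k+l-1, by recursion
   on the block from which the first factor of the result is taken; [cross p a n k] braids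
   a block of [n] factors starting at [a] past the next [k] factors. *)
Fixpoint chain p i k f := if k is k'.+1 then r p i (chain p i.+1 k' f) else f.

Fixpoint shuf p k {struct k} : nat -> nat -> tens -> tens :=
  fun l i f =>
  if k is k'.+1 then
    (fix shufl l i f {struct l} : tens :=
     if l is l'.+1 then
       tlin (q ^+ l'.+1) (shuf p k' l'.+1 i.+1 f)
            ((-1) ^+ k'.+1) (shufl l' i.+1 (chain p i k'.+1 f))
     else f) l i f
  else f.

Fixpoint cross p a n k f := if k is k'.+1 then cross p a.+1 n k' (chain p a n f) else f.

(** The image of R_j - q, as in the definition of Ups; the kernel of R_j + 1 contains it but may be
    larger when [q = -1]. *)
Definition Im p j f := exists g, f = tlin 1 (r p j g) (- q) g.

Lemma shufS p k l i f : shuf p k.+1 l.+1 i f =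
  tlin (q ^+ l.+1) (shuf p k l.+1 i.+1 f)
       ((-1) ^+ k.+1) (shuf p k.+1 l i.+1 (chain p i k.+1 f)).
Proof. by []. Qed.

Lemma shuf0l p l i f : shuf p 0 l i f = f. Proof. by []. Qed.

Lemma shuf0r p k i f : shuf p k 0 i f = f. Proof. by case: k. Qed.

Lemma chain_lin p i k : (i + k < p)%N -> linear_op (chain p i k).
Proof.
elim: k i => [|k IH] i h x f y g //=.
by rewrite IH ?braid_op_lin //; lia.
Qed.

Lemma shuf_lin p k l i : (i + k + l <= p)%N -> linear_op (shuf p k l i).
Proof.
elim: k l i => [|k IHk] l i // h; elim: l i h => [|l IHl] i h // x f y g.
rewrite !shufS IHk ?chain_lin ?IHl; try lia.
by apply: functional_extensionality => w; rewrite /tlin; ring.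
Qed.

Lemma chain_intertwine p p' i i' k F :
  (forall j f, (j < k)%N -> F (r p (i + j) f) = r p' (i' + j) (F f)) ->
  forall f, F (chain p i k f) = chain p' i' k (F f).
Proof.
elim: k i i' => [|k IH] i i' h f //=.
have := h 0 (chain p i.+1 k f); rewrite !addn0 => -> //; rewrite (IH _ i'.+1) // => j g hj.
by rewrite !addSnnS h.
Qed.

(** The operators are polynomials in the generators, so a linear map compatible with the generators
    is compatible with them. It is used with [F] a generator, a chain, a contraction or a tensor
    product with a fixed factor. *)
Lemma shuf_intertwine p p' i i' k l F : linear_op F ->
  (forall j f, (j.+1 < k + l)%N -> F (r p (i + j) f) = r p' (i' + j) (F f)) ->
  forall f, F (shuf p k l i f) = shuf p' k l i' (F f).
Proof.
move=> Flin; elim: k l i i' => [|k IHk] l i i' //.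
elim: l i i' => [|l IHl] i i' // h f.
rewrite !shufS Flin (IHk _ _ i'.+1) 1?(IHl _ i'.+1) 1?(@chain_intertwine _ p' _ i') // => j g hj.
- by apply: h; lia.
- by rewrite !addSnnS h //; lia.
- by rewrite !addSnnS h //; lia.
Qed.

Lemma Im_intertwine p p' j j' F : linear_op F ->
  (forall f, F (r p j f) = r p' j' (F f)) -> forall f, Im p j f -> Im p' j' (F f).
Proof. by move=> Flin h _ [g ->]; exists (F g); rewrite Flin h. Qed.

Lemma Im_lin p j x f y g : (j.+1 < p)%N -> Im p j f -> Im p j g -> Im p j (tlin x f y g).
Proof.
move=> hj [f' ->] [g' ->]; exists (tlin x f' y g'); rewrite braid_op_lin //.
by apply: functional_extensionality => w; rewrite /tlin; ring.
Qed.

Lemma Im_zero p j f : (j.+1 < p)%N -> Im p j (tlin 0 f 0 f).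
Proof.
move=> hj; exists (tlin 0 f 0 f); rewrite braid_op_lin //.
by apply: functional_extensionality => w; rewrite /tlin; ring.
Qed.

Lemma Im_scale p j x f g : (j.+1 < p)%N -> Im p j f -> Im p j (tlin x f 0 g).
Proof.
move=> hj If; have -> : tlin x f 0 g = tlin x f 0 f.
  by apply: functional_extensionality => w; rewrite /tlin; ring.
exact: Im_lin.
Qed.

Lemma chain_cat p i k l f : chain p i (k + l) f = chain p i k (chain p (i + k) l f).
Proof. by elim: k i f => [|k IH] i f /=; rewrite ?addn0 // IH addSnnS. Qed.

Hypothesis heckeR : hecke Rc q.

Lemma braid_opN1 p j f : (j.+1 < p)%N -> Im p j f -> r p j f = tlin (-1) f 0 f.
Proof.
move=> hj [g ->]; rewrite braid_op_lin // (braid_op_quad heckeR) //.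
by apply: functional_extensionality => w; rewrite /tlin; ring.
Qed.

Lemma chain_far p i k j f : (i + k < p)%N -> (j.+1 < p)%N -> (j.+1 < i)%N || (i + k < j)%N ->
  r p j (chain p i k f) = chain p i k (r p j f).
Proof.
move=> hp hj hij; apply: (chain_intertwine (F := r p j)) => e g he.
case/orP: hij => hij; first by rewrite braid_op_comm //; lia.
by rewrite [RHS]braid_op_comm //; lia.
Qed.

Lemma shuf_far p k l i j f : (i + k + l <= p)%N -> (j.+1 < p)%N -> (j.+1 < i)%N || (i + k + l <= j)%N ->
  r p j (shuf p k l i f) = shuf p k l i (r p j f).
Proof.
move=> hp hj hij; apply: (shuf_intertwine (F := r p j)); first by move=> ????; apply: braid_op_lin.
move=> e g he; case/orP: hij => hij; first by rewrite braid_op_comm //; lia.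
by rewrite [RHS]braid_op_comm //; lia.
Qed.

(** A crossing inside the block slides under the strand that the chain carries over; the braid
    relation is needed only at [j = i], the rest is commutation. *)
Lemma chain_shift p i k j f : (i + k < p)%N -> (i <= j)%N -> (j.+1 < i + k)%N ->
  chain p i k (r p j f) = r p j.+1 (chain p i k f).
Proof.
elim: k i => [|k IH] i hp hij hj; first by lia.
have [eij|ne] := eqVneq j i; last first.
  by rewrite /= IH; try lia; rewrite braid_op_comm //; lia.
subst j; case: k IH hp hj => [|k] IH hp hj /=; first by lia.
rewrite -chain_far; try lia.
by rewrite (braid_op_braid heckeR) //; lia.
Qed.

Lemma chain_shuf p i k j a b f : (i + k < p)%N -> (i <= j)%N -> (j + a + b <= i + k)%N ->
  chain p i k (shuf p a b j f) = shuf p a b j.+1 (chain p i k f).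
Proof.
move=> hp hij hj; apply: (shuf_intertwine (F := chain p i k)); first exact: chain_lin.
by move=> e g he; rewrite chain_shift // ; lia.
Qed.

Lemma chain_shuf_far p i k j a b f : (i + k < p)%N -> (j + a + b <= p)%N -> (i + k < j)%N ->
  chain p i k (shuf p a b j f) = shuf p a b j (chain p i k f).
Proof.
move=> hp hij hj; apply: (shuf_intertwine (F := chain p i k)); first exact: chain_lin.
by move=> e g he; rewrite chain_far // ; lia.
Qed.

(** The two chains carry two neighbouring factors past the same block of [n]; the crossing of these
    two factors slides through the block. *)
Lemma chain_chain p i n f : (i + n.+1 < p)%N ->
  chain p i.+1 n (chain p i n (r p (i + n) f)) = r p i (chain p i.+1 n (chain p i n f)).
Proof.
elim: n i => [|n IH] i hp; first by rewrite addn0.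
rewrite /= -!(@chain_far p i.+2 n i); try lia.
rewrite -addSnnS IH; last by lia.
by rewrite (braid_op_braid heckeR) //; lia.
Qed.

(** Both sides are sums over shuffles of three blocks. They are split by the block that supplies the
    first factor: [T1], [T2] and [T3] match the terms for the first, second and third block, and
    [T4] separates the last two on the right-hand side. *)
Lemma shuf_assoc p k l m i f : (i + k + l + m <= p)%N ->
  shuf p (k + l) m i (shuf p k l i f) = shuf p k (l + m) i (shuf p l m (i + k) f).
Proof.
elim: k l m i f => [|k IHk]; first by move=> l m i f _; rewrite addn0 !shuf0l.
elim=> [|l IHl] m; first by move=> i f _; rewrite addn0 add0n shuf0r shuf0l.
elim: m => [|m IHm] i f hp; first by rewrite addn0 !shuf0r.
have eik : (i + k.+1 = i.+1 + k)%N by lia.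
have ekl : (k.+1 + l.+1 = (k + l.+1).+1)%N by lia.
have ekl' : (k + l.+1 = k.+1 + l)%N by lia.
have elm : (l.+1 + m.+1 = (l + m.+1).+1)%N by lia.
have elm' : (l + m.+1 = l.+1 + m)%N by lia.
have T1 : shuf p (k + l.+1) m.+1 i.+1 (shuf p k l.+1 i.+1 f) =
          shuf p k (l.+1 + m.+1) i.+1 (shuf p l.+1 m.+1 (i + k.+1) f).
  by rewrite eik IHk //; lia.
have T2 : shuf p (k + l.+1) m.+1 i.+1 (shuf p k.+1 l i.+1 (chain p i k.+1 f)) =
          shuf p k.+1 (l + m.+1) i.+1 (chain p i k.+1 (shuf p l m.+1 (i + k.+1).+1 f)).
  rewrite ekl' IHl; last by lia.
  by rewrite addSn [RHS]/= -!/(chain p i k.+1 _) chain_shuf_far //; lia.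
have T3 : shuf p (k.+1 + l.+1) m i.+1 (chain p i (k.+1 + l.+1) (shuf p k.+1 l.+1 i f)) =
          shuf p k.+1 (l + m.+1) i.+1 (chain p i k.+1
            (shuf p l.+1 m (i + k.+1).+1 (chain p (i + k.+1) l.+1 f))).
  rewrite chain_shuf; try lia.
  rewrite IHm; last by lia.
  by rewrite addSn chain_cat chain_shuf_far ?elm' //; lia.
have T4 : shuf p k.+1 (l + m.+1) i.+1 (chain p i k.+1 (shuf p l.+1 m.+1 (i + k.+1) f)) =
    tlin (q ^+ m.+1) (shuf p k.+1 (l + m.+1) i.+1 (chain p i k.+1 (shuf p l m.+1 (i + k.+1).+1 f)))
      ((-1) ^+ l.+1) (shuf p k.+1 (l + m.+1) i.+1 (chain p i k.+1
            (shuf p l.+1 m (i + k.+1).+1 (chain p (i + k.+1) l.+1 f)))).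
  by rewrite [shuf p l.+1 m.+1 _ f]shufS chain_lin ?shuf_lin //; lia.
rewrite {1}ekl shufS -ekl T3 [X in shuf p (k + l.+1) _ _ X]shufS shuf_lin; last by lia.
rewrite T1 T2 {2}elm [RHS]shufS -elm T4.
apply: functional_extensionality => w; rewrite /tlin elm !exprS !exprD !exprS; ring.
Qed.

Lemma Im_chain p k i j f : (i + k < p)%N -> (i <= j)%N -> (j.+1 < i + k)%N ->
  Im p j f -> Im p j.+1 (chain p i k f).
Proof.
move=> hp hij hj; apply: (Im_intertwine (p := p) (j := j) (F := chain p i k)).
  exact: chain_lin.
by move=> g; rewrite chain_shift.
Qed.

Lemma Im_chain_far p k i j f : (i + k < p)%N -> (j.+1 < p)%N -> (j.+1 < i)%N || (i + k < j)%N ->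
  Im p j f -> Im p j (chain p i k f).
Proof.
move=> hp hj hij; apply: (Im_intertwine (p := p) (j := j) (F := chain p i k)).
  exact: chain_lin.
by move=> g; rewrite chain_far.
Qed.

Lemma Im_shuf_far p k l i j f : (i + k + l <= p)%N -> (j.+1 < p)%N ->
  (j.+1 < i)%N || (i + k + l <= j)%N -> Im p j f -> Im p j (shuf p k l i f).
Proof.
move=> hp hj hij; apply: (Im_intertwine (p := p) (j := j) (F := shuf p k l i)).
  exact: shuf_lin.
by move=> g; rewrite shuf_far.
Qed.

(* The operators preserve the property of lying in Ups(k) (x) Ups(l): only the
   generator at the junction i + k - 1 is unconstrained. *)
Lemma Im_shuf p k l i f : (i + k + l <= p)%N ->
  (forall j, (i <= j)%N -> (j.+1 < i + k + l)%N -> j.+1 != (i + k)%N -> Im p j f) ->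
  forall j, (i <= j)%N -> (j.+1 < i + k + l)%N -> Im p j (shuf p k l i f).
Proof.
elim: k l i f => [|k IHk] l; first by move=> i f hp h j hij hj; apply: h => //; apply/eqP; lia.
elim: l => [|l IHl] i f hp h; first by move=> j hij hj; rewrite shuf0r; apply: h => //; apply/eqP; lia.
move=> j hij hj; have [eij|ne] := eqVneq j i; last first.
  rewrite shufS; apply: Im_lin; [lia| |].
    by apply: IHk => [|e||]; try lia; move=> *; apply: h; lia.
  apply: IHl => [|e he1 he2 he3| |]; try lia.
  have [le|gt] := leqP e (i + k.+1).
    by case: e le he1 he2 he3 => // e *; apply: Im_chain; try lia; apply: h; lia.
  by apply: Im_chain_far; try lia; apply: h; lia.
(* At the front, terms are sorted by the origin of the first two factors. If both come from one
   block, the term is already in the image ([t], [t']). The mixed terms are multiples of [G] and of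
   R_i [G], and their coefficients combine to a multiple of (R_i - q) [G]. *)
subst j; pose G := shuf p k l i.+2 (chain p i.+1 k f).
have [t It Et] : exists2 t, Im p i t & shuf p k l.+1 i.+1 f = tlin 1 t ((-1) ^+ k) G.
  case: k @G {IHk IHl} hp h hj => [|k] G hp h hj.
    exists (tlin 0 f 0 f); first by apply: Im_zero; lia.
    by apply: functional_extensionality => w; rewrite /G /= /tlin expr0; ring.
  exists (tlin (q ^+ l.+1) (shuf p k l.+1 i.+2 f) 0 f); last first.
    by rewrite shufS /G; apply: functional_extensionality => w; rewrite /tlin; ring.
  have If : Im p i f by apply: h; lia.
  by apply: Im_scale; [lia | apply: Im_shuf_far; try lia].
have [t' It' Et'] : exists2 t', Im p i t' & shuf p k.+1 l i.+1 (chain p i k.+1 f) = tlin 1 t' (q ^+ l) (r p i G).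
  have EG : r p i G = shuf p k l i.+2 (chain p i k.+1 f) by rewrite shuf_far //=; lia.
  case: l @G EG {IHk IHl Et} hp h hj => [|l] G EG hp h hj.
    exists (tlin 0 f 0 f); first by apply: Im_zero; lia.
    by rewrite EG !shuf0r; apply: functional_extensionality => w; rewrite /tlin expr0; ring.
  exists (tlin ((-1) ^+ k.+1) (shuf p k.+1 l i.+2 (chain p i.+1 k.+1 (chain p i k.+1 f))) 0 f); last first.
    by rewrite shufS EG; apply: functional_extensionality => w; rewrite /tlin; ring.
  (* The first two factors of the second block are carried to the front together, and the image
     condition travels with them by [chain_chain]. *)
  have [g Eg] : Im p (i + k.+1) f by apply: h; lia.
  have If : Im p i (chain p i.+1 k.+1 (chain p i k.+1 f)).
    exists (chain p i.+1 k.+1 (chain p i k.+1 g)).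
    by rewrite Eg !chain_lin -?chain_chain //; lia.
  by apply: Im_scale; [lia | apply: Im_shuf_far; try lia].
rewrite shufS Et Et'.
have -> : tlin (q ^+ l.+1) (tlin 1 t ((-1) ^+ k) G) ((-1) ^+ k.+1) (tlin 1 t' (q ^+ l) (r p i G)) =
  tlin 1 (tlin (q ^+ l.+1) t ((-1) ^+ k.+1) t') (q ^+ l * (-1) ^+ k.+1) (tlin 1 (r p i G) (- q) G).
  by apply: functional_extensionality => w; rewrite /tlin !exprS; ring.
by apply: Im_lin; [lia | apply: Im_lin => //; lia | exists G].
Qed.

End Shuffles.

(** * Contractions, tensor products and the braiding of blocks *)

Section Crossing.
Variables (K : fieldType) (d : nat) (Rc : 'I_d -> 'I_d -> 'I_d -> 'I_d -> K) (q : K).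
Local Notation tens := (tens K d).
Local Notation r := (braid_op Rc q).
Local Notation chain := (chain Rc q).
Local Notation shuf := (shuf Rc q).
Local Notation cross := (cross Rc q).
Local Notation Im := (Im Rc q).
Local Notation Ups := (Ups Rc q).
Implicit Types (f g h : tens) (u v w : seq 'I_d) (F : tens -> tens).

Lemma ctr_shuf u p k l i f : (i + k + l <= p)%N ->
  ctr u (shuf (size u + p) k l (size u + i) f) = shuf p k l i (ctr u f).
Proof.
move=> hp; apply: (shuf_intertwine (F := ctr u)) => // j g hj.
by rewrite -addnA ctr_braid_op //; lia.
Qed.

Lemma Im_ctr u p j f : (j.+1 < p)%N -> Im (size u + p) (size u + j) f -> Im p j (ctr u f).
Proof.
move=> hj; apply: (Im_intertwine (p := size u + p) (j := size u + j) (F := ctr u)) => // g.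
exact: ctr_braid_op.
Qed.

Lemma Im_ctrr v p j f : (j.+1 < p)%N -> Im (p + size v) j f -> Im p j (ctrr v f).
Proof.
move=> hj; apply: (Im_intertwine (p := p + size v) (j := j) (F := ctrr v)) => // g.
exact: ctrr_braid_op.
Qed.

(** In degree [p] the operators [Rop] and [braid_op] agree. A preimage under [braid_op] may have
    other components, so it is cut down to degree [p], which changes nothing there. *)
Lemma UpsP p f : Ups p f <-> homog p f /\ forall j, (j.+1 < p)%N -> Im p j f.
Proof.
split=> -[hf h]; split=> // j /h [g].
  case=> hg eg; exists g; apply: (@tens_ext _ _ p) => w hw; rewrite /tlin.
    by rewrite /braid_op hw eqxx eg; ring.
  by rewrite braid_op_off // hf // hg //; ring.
move=> eg; exists (Defs.comp p g); split=> [w /negbTE hw|w]; first by rewrite /Defs.comp hw.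
have [hw|hw] := eqVneq (size w) p; last first.
  rewrite hf // (@Rop_ext _ _ _ _ _ (@tzero K d)) => [|z ez]; last by rewrite /Defs.comp ez (negbTE hw).
  rewrite /Defs.comp (negbTE hw) mulr0 subr0 /Rop; case: w {hw} => // x w; case: ifP => // _.
  by rewrite big1 // => a _; rewrite big1 // => b _; rewrite mulr0.
rewrite (@Rop_ext _ _ _ _ _ g) => [|z ez]; last by rewrite /Defs.comp ez hw eqxx.
by rewrite /Defs.comp hw eqxx eg /tlin /braid_op hw eqxx; ring.
Qed.

(** Contracting all factors outside the window of length [N] leaves an element of Ups(N), so every
    coefficient of [f] is zero. *)
Lemma Ups_vanish N p a f : zero_sp (Ups N) -> (a + N <= p)%N -> homog p f ->
  (forall j, (a <= j)%N -> (j.+1 < a + N)%N -> Im p j f) -> f = @tzero K d.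
Proof.
move=> hN hp hf h; apply: (@tens_ext _ _ p) => w hw; last by rewrite hf.
have [u [s [v [ew su ss]]]] : exists u s v, [/\ w = u ++ s ++ v, size u = a & size s = N].
  by apply: word_inner; lia.
have sv : p = (a + (N + size v))%N by rewrite -hw ew !size_cat su ss.
rewrite ew -[f _]/(ctrr v (ctr u f) s) hN //; apply/UpsP; split=> [z hz|j hj].
  rewrite /ctrr /ctr hf // !size_cat su sv; lia.
apply: Im_ctrr => //; apply: Im_ctr; first by lia.
by rewrite su -sv; apply: h; lia.
Qed.

Lemma homog_braid_op p j f : homog p f -> homog p (r p j f).
Proof. by move=> hf w hw; rewrite braid_op_off // hf // mulr0. Qed.

Lemma homog_chain p i k f : homog p f -> homog p (chain p i k f).
Proof. by move=> hf; elim: k i => [|k IH] i //=; apply: homog_braid_op. Qed.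

Lemma homog_tlin p x f y g : homog p f -> homog p g -> homog p (tlin x f y g).
Proof. by move=> hf hg w hw; rewrite /tlin hf // hg //; ring. Qed.

Lemma homog_shuf p k l i f : homog p f -> homog p (shuf p k l i f).
Proof.
elim: k l i f => [|k IHk] // l i f hf; elim: l i f hf => [|l IHl] i f hf //.
by rewrite shufS; apply: homog_tlin; [apply: IHk | apply: IHl; apply: homog_chain].
Qed.

(** Tensor product with the cut prescribed at [k], whereas [tmul] sums over all cuts; only the
    components of degrees [k] and [l] matter. *)
Definition tpr (k l : nat) f g : tens :=
  fun w => if size w == (k + l)%N then f (take k w) * g (drop k w) else 0.

Lemma tpr_cat k l f g u v : size u = k -> size v = l -> tpr k l f g (u ++ v) = f u * g v.
Proof. by move=> su sv; rewrite /tpr size_cat su sv eqxx -su take_size_cat // drop_size_cat. Qed.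

Lemma homog_tpr k l f g : homog (k + l) (tpr k l f g).
Proof. by move=> w /negbTE h; rewrite /tpr h. Qed.

Lemma tpr_linl k l g : linear_op (fun f => tpr k l f g).
Proof.
move=> x f y f'; apply: functional_extensionality => w; rewrite /tpr /tlin.
by case: ifP => _; ring.
Qed.

Lemma tpr_linr k l f : linear_op (tpr k l f).
Proof.
move=> x g y g'; apply: functional_extensionality => w; rewrite /tpr /tlin.
by case: ifP => _; ring.
Qed.

Lemma size_split k l w : size w = (k + l)%N ->
  exists u v, [/\ w = u ++ v, size u = k & size v = l].
Proof.
move=> hw; exists (take k w), (drop k w); rewrite cat_take_drop size_take size_drop hw; split=> //; [case: ltnP; lia | lia].
Qed.

Lemma tpr_braid_op_l k l j f g : (j.+1 < k)%N ->
  tpr k l (r k j f) g = r (k + l) j (tpr k l f g).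
Proof.
move=> hj; apply: (@tens_ext _ _ (k + l)) => w hw; last first.
  by rewrite homog_tpr // braid_op_off // homog_tpr // mulr0.
have [u [v [-> su sv]]] := size_split hw.
rewrite tpr_cat // -[RHS]/(ctrr v (r (k + l) j _) u) -sv ctrr_braid_op // /braid_op su eqxx mulrC sv.
have [s [a [b [t [eu es]]]]] : exists s a b t, u = s ++ a :: b :: t /\ size s = j.
  by apply: word_split; rewrite su.
subst u j; rewrite !Rop_cat mulr_sumr; apply: eq_bigr => x _; rewrite mulr_sumr.
apply: eq_bigr => y _; rewrite /ctrr tpr_cat //; first by ring.
by rewrite -su !size_cat.
Qed.

Lemma tpr_braid_op_r k l j f g : (j.+1 < l)%N ->
  tpr k l f (r l j g) = r (k + l) (k + j) (tpr k l f g).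
Proof.
move=> hj; apply: (@tens_ext _ _ (k + l)) => w hw; last first.
  by rewrite homog_tpr // braid_op_off // homog_tpr // mulr0.
have [u [v [-> su sv]]] := size_split hw.
rewrite tpr_cat // -[RHS]/(ctr u (r (k + l) (k + j) _) v) -su ctr_braid_op // /braid_op sv eqxx su.
have [s [a [b [t [ev es]]]]] : exists s a b t, v = s ++ a :: b :: t /\ size s = j.
  by apply: word_split; rewrite sv.
subst v j; rewrite !Rop_cat mulr_sumr; apply: eq_bigr => x _; rewrite mulr_sumr.
apply: eq_bigr => y _; rewrite /ctr tpr_cat //; first by ring.
by rewrite -sv !size_cat.
Qed.

Lemma tpr_shuf_l k l a b i f g : (i + a + b <= k)%N ->
  tpr k l (shuf k a b i f) g = shuf (k + l) a b i (tpr k l f g).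
Proof.
move=> hk; apply: (shuf_intertwine (F := fun f => tpr k l f g)); first exact: tpr_linl.
by move=> j h hj; rewrite tpr_braid_op_l //; lia.
Qed.

Lemma tpr_shuf_r k l a b i f g : (i + a + b <= l)%N ->
  tpr k l f (shuf l a b i g) = shuf (k + l) a b (k + i) (tpr k l f g).
Proof.
move=> hl; apply: (shuf_intertwine (F := tpr k l f)); first exact: tpr_linr.
by move=> j h hj; rewrite tpr_braid_op_r ?addnA //; lia.
Qed.

Lemma Im_tpr k l f g : Ups k f -> Ups l g ->
  forall j, (j.+1 < k + l)%N -> j.+1 != k -> Im (k + l) j (tpr k l f g).
Proof.
move=> /UpsP[_ If] /UpsP[_ Ig] j hj nj; have [lt|ge] := ltnP j.+1 k.
  apply: (Im_intertwine (p := k) (j := j) (F := fun f => tpr k l f g)); last exact: If.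
    exact: tpr_linl.
  by move=> h; rewrite tpr_braid_op_l.
have ej : j = (k + (j - k))%N by lia.
rewrite ej; apply: (Im_intertwine (p := l) (j := j - k) (F := tpr k l f)).
- exact: tpr_linr.
- by move=> h; rewrite tpr_braid_op_r //; lia.
- by apply: Ig; lia.
Qed.

Hypothesis heckeR : hecke Rc q.

Fixpoint chain_inv p i k f := if k is k'.+1 then chain_inv p i.+1 k' (braid_inv Rc q p i f) else f.

Lemma chainK p i k : (i + k < p)%N -> cancel (chain p i k) (chain_inv p i k).
Proof. by elim: k i => [|k IH] i h f //=; rewrite braid_opK ?IH //; lia. Qed.

Lemma chain_invK p i k : (i + k < p)%N -> cancel (chain_inv p i k) (chain p i k).
Proof. by elim: k i => [|k IH] i h f //=; rewrite IH ?braid_invK //; lia. Qed.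

Lemma cross_lin p a n k : (a + n + k <= p)%N -> linear_op (cross p a n k).
Proof.
by elim: k a => [|k IH] a h x f y g //=; rewrite chain_lin ?IH //; lia.
Qed.

Lemma cross_inj p a n k : (a + n + k <= p)%N -> injective (cross p a n k).
Proof.
elim: k a => [|k IH] a h f g //= /IH e.
by apply: (can_inj (@chainK p a n _)); [lia | apply: e; lia].
Qed.

Lemma homog_chain_inv p i k f : homog p f -> homog p (chain_inv p i k f).
Proof.
elim: k i f => [|k IH] i f hf //=; apply: IH; apply: homog_tlin => //.
exact: homog_braid_op.
Qed.

Lemma cross_surj p a n k f : (a + n + k <= p)%N ->
  exists g, cross p a n k g = f /\ (homog p f -> homog p g).
Proof.
elim: k a => [|k IH] a h /=; first by exists f.
have [|g [eg hg]] := IH a.+1; first by lia.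
exists (chain_inv p a n g); split; first by rewrite chain_invK //; lia.
by move=> hf; apply: homog_chain_inv; apply: hg.
Qed.

Lemma cross_far p a n k j f : (a + n + k <= p)%N -> (j.+1 < a)%N ->
  cross p a n k (r p j f) = r p j (cross p a n k f).
Proof.
elim: k a f => [|k IH] a f h hj //=.
by rewrite -chain_far ?IH //; lia.
Qed.

Lemma cross_shift p a n k j f : (a + n + k <= p)%N -> (a <= j)%N -> (j.+1 < a + n)%N ->
  cross p a n k (r p j f) = r p (j + k) (cross p a n k f).
Proof.
elim: k a j f => [|k IH] a j f h hj1 hj2 /=; first by rewrite addn0.
by rewrite chain_shift ?IH ?addSnnS //; lia.
Qed.

Lemma cross_unshift p a n k j f : (a + n + k <= p)%N -> (j.+1 < k)%N ->
  cross p a n k (r p (a + n + j) f) = r p (a + j) (cross p a n k f).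
Proof.
elim: k a j f => [|k IH] a j f h hj //=.
case: j hj => [|j] hj.
  case: k IH h hj => // k _ h _ /=.
  by rewrite !addn0 (chain_chain heckeR) ?cross_far //; lia.
rewrite -chain_far; try lia.
have -> : (a + n + j.+1 = a.+1 + n + j)%N by lia.
by rewrite IH ?addSnnS //; lia.
Qed.

(** The braiding is bijective and conjugates the generators inside each block to those inside the
    displaced block, so image conditions pull back; only the junction is lost, and it moves from
    [a + k] to [a + n]. *)
Lemma Im_cross_inv p a n k f : (a + n + k <= p)%N ->
  (forall j, (a <= j)%N -> (j.+1 < a + n + k)%N -> j.+1 != (a + k)%N -> Im p j (cross p a n k f)) ->
  forall j, (a <= j)%N -> (j.+1 < a + n + k)%N -> j.+1 != (a + n)%N -> Im p j f.
Proof.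
move=> hp h j hj1 hj2 nj.
have step j' : (forall g, cross p a n k (r p j g) = r p j' (cross p a n k g)) ->
    Im p j' (cross p a n k f) -> Im p j f.
  move=> hr [g eg]; have [g' [eg' _]] := @cross_surj p a n k g hp.
  exists g'; apply: (cross_inj hp); by rewrite cross_lin // hr eg' eg.
have [lt|ge] := ltnP j.+1 (a + n).
  by apply: (step (j + k)%N) => [g|]; [apply: cross_shift | apply: h; lia].
have ej : j = (a + n + (j - (a + n)))%N by lia.
apply: (step (a + (j - (a + n)))%N) => [g|]; last by apply: h; lia.
by rewrite {1}ej cross_unshift //; lia.
Qed.

Lemma chain_sign p i k f : (i + k < p)%N -> (forall j, (i <= j < i + k)%N -> Im p j f) ->
  chain p i k f = tlin ((-1) ^+ k) f 0 f.
Proof.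
elim: k i => [|k IH] i h If /=.
  by apply: functional_extensionality => w; rewrite /tlin; ring.
rewrite IH; [|lia|by move=> j hj; apply: If; lia].
rewrite braid_op_lin; last by lia.
rewrite braid_opN1 //; [|lia|by apply: If; lia].
by apply: functional_extensionality => w; rewrite /tlin exprS; ring.
Qed.

(* For [f = om (x) x] the left side multiplies the last [n - k] factors of [om] by [x], and
   the right side braids [om] past [x]. The step from [k] to [k+1] is the first-factor
   recursion applied to an element of Ups(n+1), which vanishes. *)
Lemma shuf_cross n k : zero_sp (Ups n.+1) -> (k <= n)%N ->
  exists2 c : K, c != 0 & forall a p f, (a + n + k <= p)%N -> homog p f ->
    (forall j, (a <= j)%N -> (j.+1 < a + n + k)%N -> j.+1 != (a + n)%N -> Im p j f) ->
    shuf p (n - k) k (a + k) f = tlin c (cross p a n k f) 0 f.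
Proof.
move=> Un1; elim: k => [|k IH] hk.
  exists 1; rewrite ?oner_neq0 // => a p f _ _ _; rewrite shuf0r.
  by apply: functional_extensionality => w; rewrite /tlin /=; ring.
have [|c c0 hc] := IH; first by lia.
have q0 : q != 0 by apply: (q_neq0 heckeR).
pose m := (n - k.+1)%N; have em : (n - k = m.+1)%N by lia.
(* The factor (-1)^m q^(k+1) comes from the relation [V] below, and (-1)^k from a chain of length
   [k] acting by its sign. *)
exists (c * ((-1) ^+ (m + k) / q ^+ k.+1)).
  by rewrite !mulf_neq0 ?signr_eq0 ?invr_eq0 ?expf_neq0.
move=> a p f hp hf If.
pose g := shuf p m k.+1 (a + k).+1 f.
pose h := shuf p m.+1 k (a + k).+1 (chain p (a + k) m.+1 f).
(* The left side is the recursion for the shuffle of the last m + 1 factors of the first block with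
   all k + 1 factors of the second, a window of n + 1 factors. *)
have V : tlin (q ^+ k.+1) g ((-1) ^+ m.+1) h = @tzero K d.
  apply: (@Ups_vanish n.+1 p (a + k)) => //; first by lia.
    exact: (@homog_shuf p m.+1 k.+1).
  move=> j hj1 hj2; apply: (@Im_shuf _ _ _ _ heckeR p m.+1 k.+1) => [|e he1 he2 he3||]; try lia.
  by apply: If; lia.
have Eh : h = tlin ((-1) ^+ m * q ^+ k.+1) g 0 g.
  apply: functional_extensionality => w; have := congr1 (@^~ w) V.
  rewrite /tlin /tzero [(-1) ^+ _]exprS => /eqP; rewrite addr_eq0 => /eqP e.
  have s2 : (-1) ^+ m * (-1) ^+ m = 1 :> K by rewrite -expr2 sqrr_sign.
  transitivity ((-1) ^+ m * (-1) ^+ m * h w); first by rewrite s2 mul1r.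
  by rewrite mul0r addr0 -[RHS]mulrA e; ring.
(* The induction hypothesis applies after the block of [n] has been braided past one factor, hence
   starts at [a + 1]. *)
have E : shuf p (n - k) k (a.+1 + k) (chain p a n f) = tlin c (cross p a n k.+1 f) 0 (chain p a n f).
  apply: hc; [lia|exact: homog_chain|move=> j hj1 hj2 nj].
  have [lt|ge] := ltnP (a + n) j; first by apply: Im_chain_far; try lia; apply: If; lia.
  by case: j hj1 hj2 nj ge => // j *; apply: (Im_chain heckeR); try lia; apply: If; lia.
(* The operator defining [g] starts at a + k + 1, so [g] inherits from [f] the image conditions on
   the first factors of the block; there each generator of the remaining chain acts by -1. *)
have Ig j : (a <= j < a + k)%N -> Im p j g.
  by move=> hj; apply: Im_shuf_far; try lia; apply: If; lia.
have E' : shuf p (n - k) k (a.+1 + k) (chain p a n f) =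
    tlin ((-1) ^+ m * q ^+ k.+1 * (-1) ^+ k) g 0 g.
  have -> : chain p a n f = chain p a k (chain p (a + k) m.+1 f).
    by rewrite -chain_cat; congr (chain _ _ _ _); lia.
  rewrite em addSn -chain_shuf_far -?/h; try lia.
  rewrite Eh chain_lin ?(chain_sign _ Ig); try lia.
  by apply: functional_extensionality => w; rewrite /tlin; ring.
rewrite addnS -/m -/g; apply: functional_extensionality => w.
have := congr1 (@^~ w) (etrans (esym E') E); rewrite /tlin !mul0r !addr0 => e.
have s2 : (-1) ^+ (m + k) * (-1) ^+ (m + k) = 1 :> K by rewrite -expr2 sqrr_sign.
rewrite mulrAC -e; transitivity ((-1) ^+ (m + k) * (-1) ^+ (m + k) * g w); first by rewrite s2 mul1r.
have : q ^+ k.+1 != 0 by rewrite expf_neq0.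
by rewrite exprD; move: (q ^+ k.+1) => Q Q0; field.
Qed.

End Crossing.

(** * Shuffles and their reduced words *)

Section Perms.
Variable m : nat.
Implicit Types (s t : 'S_m) (i j x y : 'I_m) (k : nat).

Lemma tauE j i : i = j.+1 :> nat -> tau m j = tperm j i.
Proof.
move=> e; rewrite /tau; move: (erefl (j.+1 < m)%N).
case: {2 3}(j.+1 < m)%N => h; last by have := ltn_ord i; rewrite e h.
by congr (tperm _ _); apply: val_inj.
Qed.

Lemma tau_val j i x : i = j.+1 :> nat ->
  tau m j x = (if x == j then i else if x == i then j else x).
Proof. by move=> e; rewrite (tauE e) permE /=. Qed.

(** In this product [s] acts first, so the values [j] and [j + 1] are exchanged; the only new
    inversion is the pair of positions holding them. *)
Lemma len_mul_tau s j i : i = j.+1 :> nat -> ((s^-1)%g j < (s^-1)%g i)%N ->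
  len (s * tau m j)%g = (len s).+1.
Proof.
move=> e lt; rewrite /len.
rewrite (@eq_card _ _ [predU1 ((s^-1)%g j, (s^-1)%g i) &
   [pred p : 'I_m * 'I_m | (p.1 < p.2)%N && (s p.2 < s p.1)%N]]).
  by rewrite cardU1 !inE /= !permKV e (_ : (j.+1 < j)%N = false) ?andbF; last by lia.
move=> [x y]; rewrite !inE /= !permM !(tau_val _ e) xpair_eqE.
have -> : (x == (s^-1)%g j) = (s x == j) by rewrite -(inj_eq (@perm_inj _ s)) permKV.
have -> : (y == (s^-1)%g i) = (s y == i) by rewrite -(inj_eq (@perm_inj _ s)) permKV.
have lt' : s x = i -> s y = j -> ~~ (x < y)%N.
  by move=> ex ey; rewrite -leqNgt ltnW // -[y](permK s) -[x](permK s) ex ey.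
have lt2 : s x = j -> s y = i -> (x < y)%N.
  by move=> ex ey; rewrite -[y](permK s) -[x](permK s) ex ey.
rewrite -!(inj_eq val_inj) /=.
have vj (z : (ordinal m)) : (z : nat) = j -> z = j by move=> ez; apply: ord_inj.
have vi (z : (ordinal m)) : (z : nat) = i -> z = i by move=> ez; apply: ord_inj.
case: (eqVneq (s x : nat) j) => exj; case: (eqVneq (s x : nat) i) => exi; try lia;
case: (eqVneq (s y : nat) j) => eyj; case: (eqVneq (s y : nat) i) => eyi; try lia.
- by rewrite (lt2 (vj _ exj) (vi _ eyi)) /= e ltnSn.
- by rewrite (negbTE (lt' (vi _ exi) (vj _ eyj))).
Qed.

Lemma tauK j i s : i = j.+1 :> nat -> (s * tau m j * tau m j)%g = s.
Proof. by move=> e; rewrite (tauE e) -mulgA tperm2 mulg1. Qed.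

Lemma invg_tau s j i : i = j.+1 :> nat ->
  ((s * tau m j)^-1)%g j = (s^-1)%g i /\ ((s * tau m j)^-1)%g i = (s^-1)%g j.
Proof. by move=> e; rewrite invMg !permM (tauE e) tpermV tpermL tpermR. Qed.

Lemma len_mul_tau_gt s j i : i = j.+1 :> nat -> ((s^-1)%g i < (s^-1)%g j)%N ->
  len s = (len (s * tau m j)%g).+1.
Proof.
move=> e lt; rewrite -(len_mul_tau e) ?(tauK _ e) //.
by have [-> ->] := invg_tau s e.
Qed.

Lemma len_mul_tau_le s j i : i = j.+1 :> nat -> (len (s * tau m j)%g <= (len s).+1)%N.
Proof.
move=> e; case: (ltngtP ((s^-1)%g j) ((s^-1)%g i)) => h.
- by rewrite (len_mul_tau e).
- by rewrite [len s](len_mul_tau_gt e) //; lia.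
- by have := perm_inj (val_inj h) => /(congr1 val) /=; lia.
Qed.

Lemma len1 : len (1 : 'S_m)%g = 0%N.
Proof.
by apply: eq_card0 => -[x y]; rewrite !inE /= !perm1; case: ltnP => //= /ltnW; rewrite leqNgt => /negbTE.
Qed.

Lemma perm_mono_eq1 s : (forall x y, (x < y)%N -> (s x < s y)%N) -> s = 1%g.
Proof.
have ge_id t : (forall x y, (x < y)%N -> (t x < t y)%N) -> forall n x, x = n :> nat -> (x <= t x)%N.
  move=> mono; elim=> [|n IH] x ex; first by rewrite ex.
  have hn : (n < m)%N by have := ltn_ord x; lia.
  have := IH (Ordinal hn) erefl; have := mono (Ordinal hn) x; rewrite /= ex; lia.
move=> mono; have mono' x y : (x < y)%N -> ((s^-1)%g x < (s^-1)%g y)%N.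
  move=> h; case: (ltngtP ((s^-1)%g x) ((s^-1)%g y)) => //.
    by move/mono; rewrite !permKV; lia.
  by move/val_inj/perm_inj => e; rewrite e ltnn in h.
apply/permP => x; rewrite perm1; apply/val_inj/eqP; rewrite /= eqn_leq (ge_id _ mono _ x erefl) andbT.
have := ge_id _ mono' _ (s x) erefl; by rewrite permK.
Qed.

Lemma perm_adj_eq1 s : (forall x y, y = x.+1 :> nat -> (s x < s y)%N) -> s = 1%g.
Proof.
move=> adj; apply: perm_mono_eq1 => x y lt.
have : forall n y, y = (x + n).+1 :> nat -> (s x < s y)%N.
  elim=> [|n IH] z ez; first by apply: adj; lia.
  have hz : ((x + n).+1 < m)%N by have := ltn_ord z; lia.
  by apply: ltn_trans (IH (Ordinal hz) erefl) _; apply: adj => /=; lia.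
by apply; rewrite -[nat_of_ord y](subnKC lt).
Qed.

(** Bubble sort on values: either two adjacent values stand in the wrong order and exchanging them
    lowers the length, or the permutation is the identity. *)
Lemma ex_reduced_word s : exists ws : seq nat, [/\ all (fun c : nat => c.+1 < m)%N ws, size ws = len s & word_perm m ws = s].
Proof.
move: {2}(len s) (erefl (len s)) => n; elim: n s => [|n IH] s es.
all: have [/existsP[j /existsP[i /andP[/eqP e lt]]]|/existsPn noinv] :=
  boolP [exists j : 'I_m, exists i : 'I_m, (i == j.+1 :> nat) && ((s^-1)%g i < (s^-1)%g j)%N].
- by have := len_mul_tau_gt e lt; rewrite es.
- exists [::]; split=> //=; apply: invg_inj; rewrite invg1; apply/esym/perm_adj_eq1 => x y e.
  have := noinv x; rewrite negb_exists => /forallP/(_ y); rewrite e eqxx /= -leqNgt leq_eqVlt.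
  by case/orP=> // /eqP/val_inj/perm_inj exy; have := congr1 val exy => /=; lia.
- have el := len_mul_tau_gt e lt.
  have [|ws [h1 h2 h3]] := IH (s * tau m j)%g; first by lia.
  exists (val j :: ws); split=> /=; [|by lia|by rewrite h3 (tauK _ e)].
  by rewrite h1 andbT -e.
- have s1 : s = 1%g.
    apply: invg_inj; rewrite invg1; apply/perm_adj_eq1 => x y e.
    have := noinv x; rewrite negb_exists => /forallP/(_ y); rewrite e eqxx /= -leqNgt leq_eqVlt.
    by case/orP=> // /eqP/val_inj/perm_inj exy; have := congr1 val exy => /=; lia.
  by rewrite s1 len1 in es.
Qed.

(** Guarantees that the default branch of [Tact] is never taken. *)
Lemma reduced_wordP s : exists2 ws, reduced_word s = Some ws &
  [/\ all (fun c : nat => c.+1 < m)%N ws, size ws = len s & word_perm m ws = s].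
Proof.
rewrite /reduced_word; case: pickP => [t /andP[h /eqP e]|no].
  by exists (map val t) => //; split=> //; [rewrite all_map | rewrite size_map size_tuple].
have [ws [h1 h2 h3]] := ex_reduced_word s.
have [t et] : exists t : seq 'I_m, map val t = ws.
  elim: ws h1 {h2 h3} => [|j ws IH] /=; first by exists [::].
  by case/andP=> hj /IH[t et]; exists (Ordinal (ltnW hj) :: t); rewrite /= et.
have st : size t == len s by rewrite -h2 -et size_map.
by have := no (Tuple st); rewrite /= et h3 eqxx andbT -(all_map val (fun c : nat => c.+1 < m)%N) et h1.
Qed.

Lemma shuffleP k s : reflect
  (forall x y, (x < y)%N -> (y < k)%N || (k <= x)%N -> (s x < s y)%N) (shuffle k s).
Proof.
apply: (iffP forallP) => [h x y lt b|h x].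
  by have /forallP/(_ y)/implyP := h x; apply; rewrite lt.
by apply/forallP => y; apply/implyP => /andP[lt b]; apply: h.
Qed.

(* The [i]-th bit tells whether the value [i] comes from the second block. *)
Definition bits k s : seq bool := [seq (k <= (s^-1)%g i)%N | i <- enum 'I_m].

Lemma size_bits k s : size (bits k s) = m.
Proof. by rewrite size_map size_enum_ord. Qed.

Lemma nth_bits k s i : nth false (bits k s) i = (k <= (s^-1)%g i)%N.
Proof. by rewrite (nth_map i) ?size_enum_ord // nth_ord_enum. Qed.

Lemma count_bits k s : (k <= m)%N -> count negb (bits k s) = k.
Proof.
move=> hk; rewrite count_map -sum1_count big_enum_cond /= (reindex_inj (@perm_inj _ s)) /=.
under eq_bigl do rewrite permK -ltnNge.
by rewrite (big_ord_narrow hk) sum_nat_const card_ord muln1.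
Qed.

End Perms.

(** Inversions of a bit word, a [true] standing before a [false]; for the bits of a shuffle this
    number is its length. *)
Fixpoint binv (b : seq bool) : nat :=
  if b is x :: b' then ((if x then count negb b' else 0) + binv b')%N else 0.

(** Enumeration by the first bit, parallel to the recursion of [shuf]. *)
Fixpoint bitwords (n k : nat) : seq (seq bool) :=
  if n is n'.+1 then
    map (cons true) (bitwords n' k) ++ (if k is k'.+1 then map (cons false) (bitwords n' k') else [::])
  else if k is 0 then [:: [::]] else [::].

Lemma mem_bitwords n k b : (b \in bitwords n k) = (size b == n) && (count negb b == k).
Proof.
have map_cons (x y : bool) (b' : seq bool) s : (y :: b' \in map (cons x) s) = (x == y) && (b' \in s).
  apply/mapP/andP => [[c hc [-> ->]]|[/eqP-> hb]] //; by exists b'.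
elim: n k b => [|n IH] k b /=; first by case: k => [|k]; case: b => [|x b]; rewrite ?inE.
case: b => [|x b].
  have nilF (x : bool) s : ([::] \in map (cons x) s) = false by apply/mapP => -[].
  by rewrite mem_cat; case: k => [|k]; rewrite ?nilF.
rewrite mem_cat map_cons IH.
by case: k => [|k]; rewrite ?map_cons ?IH /=; case: x; rewrite /= ?add0n ?add1n ?eqSS ?orbF ?andbF.
Qed.

Lemma uniq_bitwords n k : uniq (bitwords n k).
Proof.
have cons_inj (x : bool) : injective (cons x) by move=> ? ? [].
elim: n k => [|n IH] [|k] //=; rewrite ?cats0 ?cat_uniq ?map_inj_uniq ?IH //= andbT.
by apply/hasPn => _ /mapP[b _ ->]; apply/mapP => -[].
Qed.

Lemma binv_le b : (binv b <= count negb b * count id b)%N.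
Proof. by elim: b => //= -[] b IH /=; nia. Qed.

Lemma binv_swap b1 b2 :
  binv (b1 ++ [:: true, false & b2]) = (binv (b1 ++ [:: false, true & b2])).+1.
Proof. by elim: b1 => [|x b1 /= ->] /=; [lia | rewrite !count_cat /=; case: x; lia]. Qed.

(** * Expansion of the shuffle operators over bit words *)

Section Words.
Variables (K : fieldType) (d : nat) (Rc : 'I_d -> 'I_d -> 'I_d -> 'I_d -> K) (q : K).
Local Notation tens := (tens K d).
Local Notation r := (braid_op Rc q).
Local Notation chain := (chain Rc q).
Local Notation shuf := (shuf Rc q).

(** The action of T_d for the shuffle d with bits [b], along one particular reduced word: each
    [true] carries the next factor of the second block over the [k] factors still left in the
    first. *)
Fixpoint bit_op p i k (b : seq bool) (f : tens) : tens :=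
  match b with
  | [::] => f
  | false :: b' => bit_op p i.+1 k.-1 b' f
  | true :: b' => bit_op p i.+1 k b' (chain p i k f)
  end.

Lemma bit_op_true p i c f : bit_op p i 0 (nseq c true) f = f.
Proof. by elim: c i => //= c IH i; rewrite IH. Qed.

Lemma bit_op_false p i k c f : bit_op p i k (nseq c false) f = f.
Proof. by elim: c i k => //= c IH i k; rewrite IH. Qed.

Lemma bit_op_cat_false p i k b f : bit_op p i k (nseq k false ++ b) f = bit_op p (i + k) 0 b f.
Proof. by elim: k i => [|k IH] i /=; rewrite ?addn0 // IH addSnnS. Qed.

Lemma bit_op_far p i k b j f : k = count negb b -> (i + size b <= p)%N -> (j.+1 < i)%N ->
  r p j (bit_op p i k b f) = bit_op p i k b (r p j f).
Proof.
elim: b i k f => [|x b IH] i k f //= ek hp hj.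
have := count_size negb b => hc.
case: x ek => /= ek; last by rewrite IH //; lia.
by rewrite IH ?chain_far //; lia.
Qed.

(** Left multiplication by one generator turns an ascent of the bit word into a descent; this is the
    induction step for arbitrary reduced words. *)
Lemma bit_op_swap p i k b1 b2 f : k = (count negb b1 + (count negb b2).+1)%N ->
  (i + size b1 + (size b2).+2 <= p)%N ->
  r p (i + size b1) (bit_op p i k (b1 ++ [:: false, true & b2]) f) =
  bit_op p i k (b1 ++ [:: true, false & b2]) f.
Proof.
elim: b1 i k f => [|x b1 IH] i k f /= ek hp.
  have := count_size negb b2 => hc.
  by case: k ek => // k [ek]; rewrite addn0 bit_op_far //; lia.
by case: x ek hp => /= ek hp; rewrite addnS -addSn IH //; lia.
Qed.

Lemma bitwords_gt n k : (n < k)%N -> bitwords n k = [::].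
Proof. by elim: n k => [|n IH] [|k] //= h; rewrite !IH //; lia. Qed.

Lemma bitwords_full n : bitwords n n = [:: nseq n false].
Proof. by elim: n => //= n ->; rewrite bitwords_gt. Qed.

Lemma bitwords0 n : bitwords n 0 = [:: nseq n true].
Proof. by elim: n => //= n ->. Qed.

Lemma shuf_bits p k l i f w : shuf p k l i f w =
  \sum_(b <- bitwords (k + l) k)
     (-1) ^+ binv b * q ^+ (k * l - binv b) * bit_op p i k b f w.
Proof.
have binv_nseq c x : binv (nseq c x) = 0%N.
  by elim: c => //= c ->; case: x; rewrite // count_nseq /= mul0n.
elim: k l i f => [|k IHk] l i f.
  by rewrite bitwords0 big_seq1 binv_nseq bit_op_true /= !expr0 !mul1r.
elim: l i f => [|l IHl] i f.
  by rewrite addn0 bitwords_full big_seq1 binv_nseq bit_op_false muln0 /= !expr0 !mul1r.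
have -> : bitwords (k.+1 + l.+1) k.+1 =
    map (cons true) (bitwords (k.+1 + l) k.+1) ++ map (cons false) (bitwords (k + l.+1) k).
  by rewrite addSn addSnnS.
rewrite big_cat !big_map shufS /tlin IHk IHl addrC; refine (f_equal2 (@GRing.add K) _ _).
  rewrite mulr_sumr; apply: eq_big_seq => b.
  rewrite mem_bitwords => /andP[_ /eqP hb] /=; rewrite hb exprD.
  have -> : (k.+1 * l.+1 - (k.+1 + binv b) = k.+1 * l - binv b)%N by lia.
  by ring.
rewrite mulr_sumr; apply: eq_big_seq => b.
rewrite mem_bitwords => /andP[/eqP sb /eqP hb] /=; rewrite add0n.
(* The bound keeps the natural-number subtraction in the exponent from truncating. *)
have hle : (binv b <= k * l.+1)%N.
  have := binv_le b; have := count_predC negb b.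
  by rewrite (@eq_count _ (predC negb) id) => [|x]; [rewrite hb sb; nia | rewrite /= negbK].
have -> : (k.+1 * l.+1 - binv b = l.+1 + (k * l.+1 - binv b))%N by lia.
by rewrite exprD; ring.
Qed.

Lemma split_swap (m j : nat) (b c : seq bool) : size b = m -> size c = m -> (j.+1 < m)%N ->
  (forall i, (i < m)%N -> i != j -> i != j.+1 -> nth false b i = nth false c i) ->
  exists b1 b2, [/\ size b1 = j, b = b1 ++ [:: nth false b j, nth false b j.+1 & b2] &
                    c = b1 ++ [:: nth false c j, nth false c j.+1 & b2]].
Proof.
move=> sb sc hj e; exists (take j b), (drop j.+2 b).
have split a : size a = m -> a = take j a ++ [:: nth false a j, nth false a j.+1 & drop j.+2 a].
  by move=> sa; rewrite -!drop_nth ?cat_take_drop //; lia.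
split; [by rewrite size_takel //; lia| exact: split | rewrite [LHS](split c sc)].
have st a : size a = m -> size (take j a) = j by move=> sa; rewrite size_takel //; lia.
congr (_ ++ [:: _, _ & _]).
  apply: (@eq_from_nth _ false); rewrite !st // => i hi.
  by rewrite !nth_take // e //; lia.
apply: (@eq_from_nth _ false); rewrite !size_drop ?sb ?sc // => i hi.
by rewrite !nth_drop e //; lia.
Qed.

Lemma len_word_perm m (ws : seq nat) : all (fun c : nat => c.+1 < m)%N ws ->
  (len (word_perm m ws) <= size ws)%N.
Proof.
elim: ws => [|j ws IH] /=; first by rewrite len1.
case/andP=> hj /IH h; apply: leq_trans (_ : (len (word_perm m ws)).+1 <= _)%N; last by [].
exact: (@len_mul_tau_le _ _ (Ordinal (ltnW hj)) (Ordinal hj)).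
Qed.

Lemma count_take_lt (a : pred bool) (b : seq bool) i j : (i < j)%N -> (i < size b)%N ->
  a (nth false b i) -> (count a (take i b) < count a (take j b))%N.
Proof.
move=> ij hi ha; have [e hd] : exists e, take j b = take i b ++ nth false b i :: e.
  exists (drop i.+1 (take j b)).
  have hj : (i < size (take j b))%N by rewrite size_take; case: ifP.
  rewrite -[LHS](cat_take_drop i) take_takel ?(ltnW ij) //; congr (_ ++ _).
  by rewrite (drop_nth false) // nth_take.
by rewrite hd count_cat /= ha; lia.
Qed.

Lemma bits_surj m k b : size b = m -> count negb b = k ->
  exists2 s : 'S_m, shuffle k s & bits k s = b.
Proof.
move=> sb cb.
have count_id : (count id b = m - k)%N.
  have := count_predC negb b; rewrite (@eq_count _ (predC negb) id) => [|x]; last exact: negbK.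
  by rewrite sb cb; lia.
(* [g] is the inverse of the wanted shuffle: the value [i] sits at the position given by its rank
   among the bits equal to its own, offset by [k] for the second block. *)
pose g (i : nat) := if nth false b i then (k + count id (take i b))%N else count negb (take i b).
have hk : (k <= m)%N by rewrite -cb -sb count_size.
have bound i (h : (i < m)%N) : if nth false b i then (k <= g i < m)%N else (g i < k)%N.
  rewrite -sb in h; rewrite /g; case E : (nth false b i).
    have := @count_take_lt id b i (size b) h h E; rewrite take_size count_id.
    by lia.
  by have := @count_take_lt negb b i (size b) h h; rewrite E take_size cb; apply.
have mono i j : (i < j)%N -> (j < m)%N -> nth false b i = nth false b j -> (g i < g j)%N.
  move=> ij hj e; have hi : (i < size b)%N by lia.
  rewrite /g -e; case E : (nth false b i).
    by rewrite ltn_add2l; apply: count_take_lt.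
  by apply: count_take_lt; rewrite ?E.
have gm (i : 'I_m) : (g i < m)%N.
  by have := bound i (ltn_ord i); case: ifP => _; lia.
pose G (i : 'I_m) := Ordinal (gm i).
have Ginj : injective G.
  move=> i j /(congr1 val) /= e; have := bound i (ltn_ord i); have := bound j (ltn_ord j).
  have := mono i j; have := mono j i; rewrite e !ltnn.
  case: (ltngtP i j) => [lt|lt|/ord_inj //] h1 h2.
    by have := h2 isT (ltn_ord j); do 2 case: ifP => //; lia.
  by have := h1 isT (ltn_ord i); do 2 case: ifP => //; lia.
exists ((perm Ginj)^-1)%g; last first.
  apply: (@eq_from_nth _ false) => [|i]; rewrite size_bits // => hi.
  rewrite (@nth_bits _ _ _ (Ordinal hi)) invgK permE /=.
  by have := bound i hi; case: ifP => _; lia.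
apply/shuffleP => x y lt hxy; set s := ((perm Ginj)^-1)%g.
have gs z : g (s z) = z by rewrite -[in RHS](permKV (perm Ginj) z) permE.
have sne : s x != s y :> nat.
  by apply/eqP => /ord_inj/perm_inj e; rewrite e ltnn in lt.
have := bound _ (ltn_ord (s x)); have := bound _ (ltn_ord (s y)); rewrite !gs.
have := mono _ _ _ (ltn_ord (s x)); move/(_ (s y)); rewrite !gs.
case: (ltngtP (s x) (s y)) sne => // _ _ h.
by have := h isT; do 2 case: ifP => //; lia.
Qed.

Lemma bits_inj m k (s t : 'S_m) : shuffle k s -> shuffle k t -> bits k s = bits k t -> s = t.
Proof.
move=> /shuffleP hs /shuffleP ht e.
(* Equal bits mean that each value comes from the same block in [s] and in [t]; hence s t^-1 is
   increasing, inside the blocks by the shuffle property and across them because blocks are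
   preserved. *)
have blk x : (k <= (t^-1)%g (s x))%N = (k <= x)%N.
  by rewrite -nth_bits -e nth_bits permK.
have : (s * t^-1)%g = 1%g.
  apply: perm_mono_eq1 => x y lt; rewrite !permM.
  have bx := blk x; have byy := blk y.
  have [hxy|hxy] := boolP ((y < k)%N || (k <= x)%N); last by lia.
  have lst := hs x y lt hxy.
  case: (ltngtP ((t^-1)%g (s x)) ((t^-1)%g (s y))) => // [h|/ord_inj/perm_inj/perm_inj exy].
    by have := ht _ _ h; rewrite !permKV => /(_ _); lia.
  by rewrite exy ltnn in lt.
by move/eqP; rewrite -eq_mulgV1 => /eqP.
Qed.

Lemma foldr_Rop m (ws : seq nat) f w : size w = m ->
  foldr (fun j g => Rop Rc j g) f ws w = foldr (fun j g => r m j g) f ws w.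
Proof.
elim: ws w => //= j ws IH w hw; rewrite /braid_op hw eqxx.
by apply: Rop_ext => z hz; apply: IH; rewrite hz.
Qed.

Hypothesis heckeR : hecke Rc q.

(* Lower elements of the left weak order below a shuffle are again shuffles, so all
   reduced words of a shuffle can be handled by induction without Matsumoto's theorem. *)
Lemma shuffle_word m k (ws : seq nat) f : (k <= m)%N -> all (fun c : nat => c.+1 < m)%N ws ->
  size ws = len (word_perm m ws) -> shuffle k (word_perm m ws) ->
  foldr (fun j g => r m j g) f ws = bit_op m 0 k (bits k (word_perm m ws)) f /\
  binv (bits k (word_perm m ws)) = size ws.
Proof.
move=> hk; elim: ws => [|j ws IH] /=.
  move=> _ _ _.
  have -> : bits k (1%g : 'S_m) = nseq k false ++ nseq (m - k) true.
    apply: (@eq_from_nth _ false) => [|i]; first by rewrite size_bits size_cat !size_nseq; lia.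
    rewrite size_bits => hi; rewrite (@nth_bits _ k 1%g (Ordinal hi)) invg1 perm1 /=.
    by rewrite nth_cat !nth_nseq size_nseq; case: ltnP => // hik; rewrite ifT //; lia.
  rewrite bit_op_cat_false bit_op_true; split=> //.
  have b0 c : binv (nseq c true) = 0%N by elim: c => //= c ->; rewrite count_nseq mul0n.
  have -> : forall c e, binv (nseq c false ++ e) = binv e by elim.
  by rewrite b0.
case/andP=> hj hws hsz hsh; set s' := word_perm m ws in hsz hsh IH *.
pose x := Ordinal (ltnW hj); pose y := Ordinal hj; have exy : y = x.+1 :> nat by [].
rewrite -![tau m j]/(tau m x) in hsz hsh *.
have hle := len_word_perm hws; rewrite -/s' in hle.
have lt : ((s'^-1)%g x < (s'^-1)%g y)%N.
  case: ltngtP => // h; first by have := len_mul_tau_gt exy h; lia.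
  by have := perm_inj (ord_inj h) => /(congr1 val) /=; lia.
have el := len_mul_tau exy lt.
have [ex ey] := invg_tau s' exy.
set s := (s' * tau m x)%g in hsz hsh el ex ey *.
have /shuffleP mono := hsh.
(* The values [x] and [y] form an inversion of [s], which is increasing on each block, so they come
   from different blocks. Therefore [s'] is a shuffle too, and one pair of bits turns from
   [false, true] into [true, false]. *)
have hxy : ((s'^-1)%g x < k <= (s'^-1)%g y)%N.
  have sx : s ((s'^-1)%g x) = y by rewrite -ey permKV.
  have sy : s ((s'^-1)%g y) = x by rewrite -ex permKV.
  by have := mono _ _ lt; rewrite sx sy /=; lia.
have hsh' : shuffle k s'.
  apply/shuffleP => a b lab hab; have := mono a b lab hab.
  rewrite /s !permM !(tau_val _ exy) -!(inj_eq val_inj) /=.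
  have na : s' a = x -> s' b = y -> False.
    by move=> ea eb; move: hab hxy; rewrite -ea -eb !permK; lia.
  have nb : s' a = y -> s' b = x -> False.
    by move=> ea eb; move: lt; rewrite -ea -eb !permK; lia.
  have toI (z : 'I_m) (t : 'I_m) : val z = val t -> z = t by apply: val_inj.
  case: eqVneq => [/(toI _ x) ea|nax]; [|case: eqVneq => [/(toI _ y) ea|nay]];
  (case: eqVneq => [/(toI _ x) eb|nbx]; [|case: eqVneq => [/(toI _ y) eb|nby]]);
  rewrite ?ea ?eb /= => h //; try lia; try by case: na; try by case: nb.
have [|IH1 IH2] := IH hws _ hsh'; first by lia.
have [b1 [b2 [sb1 eb eb']]] : exists b1 b2, [/\ size b1 = j, bits k s' = b1 ++ [:: false, true & b2] &
      bits k s = b1 ++ [:: true, false & b2]].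
  have [|b1 [b2]] := split_swap (size_bits k s') (size_bits k s) hj.
    move=> i hi n1 n2; rewrite !(@nth_bits _ _ _ (Ordinal hi)) /s invMg permM (tauE exy) tpermV.
    by rewrite tpermD // -(inj_eq val_inj) /= eq_sym.
  rewrite -[j.+1]/(val y) -{2 3}[j]/(val x) !nth_bits ex ey => -[h1 h2 h3].
  by exists b1, b2; split=> //; [rewrite h2 | rewrite h3]; congr (_ ++ [:: _, _ & _]); lia.
rewrite IH1 -IH2 eb' eb binv_swap; split=> //.
have ck := count_bits s' hk; have sz := size_bits k s'.
rewrite eb count_cat /= in ck; rewrite eb size_cat /= in sz.
by rewrite -[j in r m j]add0n -sb1 bit_op_swap //; lia.
Qed.

(** Shuffles correspond bijectively to bit words, and by [shuffle_word] the chosen reduced words do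
    not affect the summands. *)
Lemma yop_shuf m k f w : (k <= m)%N -> size w = m ->
  yop Rc q m k f w = shuf m k (m - k) 0 f w.
Proof.
move=> hk hw; rewrite shuf_bits subnKC //.
pose G b := (-1) ^+ binv b * q ^+ (k * (m - k) - binv b) * bit_op m 0 k b f w.
transitivity (\sum_(s : 'S_m | shuffle k s) G (bits k s)).
  apply: eq_bigr => s hs; rewrite /Tact.
  have [ws -> [h1 h2 h3]] := reduced_wordP s.
  have := @shuffle_word m k ws f hk h1; rewrite h3 => /(_ h2 hs) [e1 e2].
  by rewrite (@foldr_Rop m) // e1 /G e2 h2.
rewrite -big_filter -(big_map (bits k) predT G); apply: perm_big; apply: uniq_perm.
- rewrite map_inj_in_uniq ?filter_uniq ?index_enum_uniq // => s t.
  by rewrite !mem_filter => /andP[hs _] /andP[ht _]; apply: bits_inj.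
- exact: uniq_bitwords.
move=> b; rewrite mem_bitwords; apply/mapP/andP => [[s _ ->]|[/eqP sb /eqP cb]].
  by rewrite size_bits count_bits.
have [s hs <-] := bits_surj sb cb; exists s => //.
by rewrite mem_filter hs mem_index_enum.
Qed.

End Words.

(** * Products of tensors *)

Section Products.
Variables (K : fieldType) (d : nat).
Local Notation tens := (tens K d).
Implicit Types (f g h : tens) (u v w : seq 'I_d) (F : tens -> tens).

Lemma sum_triangle n (F : nat -> nat -> nat -> K) :
  \sum_(k < n.+1) \sum_(j < k.+1) F j (k - j)%N (n - k)%N =
  \sum_(j < n.+1) \sum_(i < (n - j).+1) F j i (n - j - i)%N.
Proof.
transitivity (\sum_(k < n.+1) \sum_(j < n.+1 | (j <= k)%N) F j (k - j)%N (n - k)%N).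
  apply: eq_bigr => k _; have hk : (k.+1 <= n.+1)%N := ltn_ord k.
  by rewrite (big_ord_widen _ (fun j => F j (k - j)%N (n - k)%N) hk); apply: eq_bigl.
rewrite (exchange_big_dep xpredT) //=; apply: eq_bigr => j _.
rewrite -(big_mkord (fun k => (j <= k)%N) (fun k => F j (k - j)%N (n - k)%N)).
rewrite -(big_mkord xpredT (fun i => F j i (n - j - i)%N)).
rewrite (big_cat_nat (n := j)) ?leq0n ?(ltnW (ltn_ord j)) //=.
rewrite big_nat_cond big1 ?add0r => [|k]; last by lia.
rewrite -{1}[nat_of_ord j]add0n big_addn -subSn; last by rewrite -ltnS.
rewrite big_nat_cond [RHS]big_nat_cond; apply: eq_big => [k|k hk].
  by rewrite leq_addl !andbT.
by congr (F j _ _); lia.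
Qed.

Lemma tmulA f g h : tmul (tmul f g) h = tmul f (tmul g h).
Proof.
apply: functional_extensionality => w; rewrite /tmul.
transitivity (\sum_(k < (size w).+1) \sum_(j < k.+1)
    f (take j w) * g (take (k - j) (drop j w)) * h (drop (j + (k - j)) w)).
  apply: eq_bigr => k _; have hk : (k <= size w)%N by rewrite -ltnS.
  rewrite size_takel // mulr_suml; apply: eq_bigr => j _.
  have hj : (j <= k)%N by rewrite -ltnS.
  by rewrite take_takel // take_drop subnK // subnKC.
rewrite (sum_triangle _ (fun j i _ => f (take j w) * g (take i (drop j w)) * h (drop (j + i) w))).
apply: eq_bigr => j _; rewrite size_drop mulr_sumr; apply: eq_bigr => i _.
by rewrite drop_drop mulrA addnC.
Qed.

Lemma tmul_linl x f y g h : tmul (tlin x f y g) h = tlin x (tmul f h) y (tmul g h).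
Proof.
apply: functional_extensionality => w; rewrite /tmul /tlin !mulr_sumr -big_split.
by apply: eq_bigr => i _; rewrite /=; ring.
Qed.

Lemma tmul_linr x f y g h : tmul h (tlin x f y g) = tlin x (tmul h f) y (tmul h g).
Proof.
apply: functional_extensionality => w; rewrite /tmul /tlin !mulr_sumr -big_split.
by apply: eq_bigr => i _; rewrite /=; ring.
Qed.

Lemma tmul_comp k l f g : tmul (Defs.comp k f) (Defs.comp l g) = tpr k l f g.
Proof.
apply: functional_extensionality => w; rewrite /tmul /tpr /Defs.comp; case: eqP => [hw|hw].
  have hk : (k < (size w).+1)%N by lia.
  rewrite (bigD1 (Ordinal hk)) //= size_takel; last by lia.
  rewrite eqxx size_drop (_ : size w - k = l)%N ?eqxx; last by lia.
  rewrite big1 ?addr0 // => i ni.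
  have hi : (i <= size w)%N by rewrite -ltnS.
  by rewrite size_takel // ifN ?mul0r.
rewrite big1 // => i _; have hi : (i <= size w)%N by rewrite -ltnS.
rewrite size_takel // size_drop.
by case: eqP => [e1|_]; rewrite ?mul0r //; case: eqP => [e2|_]; rewrite ?mulr0 //; have := ltn_ord i; lia.
Qed.

Lemma linear_op_sum F (I : Type) (s : seq I) (c : I -> K) (G : I -> tens) : linear_op F ->
  F (fun w => \sum_(i <- s) c i * G i w) = fun w => \sum_(i <- s) c i * F (G i) w.
Proof.
move=> Flin; elim: s => [|i s IH].
  have e : (fun w => \sum_(i <- [::]) c i * G i w) = tlin 0 (@tzero K d) 0 (@tzero K d).
    by apply: functional_extensionality => w; rewrite big_nil /tlin; ring.
  by rewrite e Flin; apply: functional_extensionality => w; rewrite big_nil /tlin; ring.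
transitivity (tlin (c i) (F (G i)) 1 (F (fun w => \sum_(i <- s) c i * G i w))).
  by rewrite -Flin; congr (F _); apply: functional_extensionality => w; rewrite big_cons /tlin mul1r.
by rewrite IH; apply: functional_extensionality => w; rewrite big_cons /tlin mul1r.
Qed.

Variables (Rc : 'I_d -> 'I_d -> 'I_d -> 'I_d -> K) (q : K).
Hypothesis heckeR : hecke Rc q.
Local Notation shuf := (shuf Rc q).

Lemma starE f g w : star Rc q f g w =
  \sum_(k < (size w).+1) shuf (size w) k (size w - k) 0 (tpr k (size w - k) f g) w.
Proof.
by apply: eq_bigr => k _; rewrite tmul_comp yop_shuf // -ltnS.
Qed.

Lemma tprA j i l f g h : tpr (j + i) l (tpr j i f g) h = tpr j (i + l) f (tpr i l g h).
Proof.
apply: functional_extensionality => w; rewrite /tpr addnA; case: eqP => // hw.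
rewrite size_takel ?eqxx ?size_drop ?hw; try lia.
rewrite take_takel ?leq_addr // take_drop drop_drop [(i + j)%N]addnC ifT ?mulrA //; lia.
Qed.

Lemma star_linl x f y g h : star Rc q (tlin x f y g) h = tlin x (star Rc q f h) y (star Rc q g h).
Proof.
apply: functional_extensionality => w; rewrite /tlin !starE !mulr_sumr -big_split.
apply: eq_bigr => k _ /=; rewrite tpr_linl shuf_lin //; have := ltn_ord k; lia.
Qed.

Lemma star_linr x f y g h : star Rc q h (tlin x f y g) = tlin x (star Rc q h f) y (star Rc q h g).
Proof.
apply: functional_extensionality => w; rewrite /tlin !starE !mulr_sumr -big_split.
apply: eq_bigr => k _ /=; rewrite tpr_linr shuf_lin //; have := ltn_ord k; lia.
Qed.

(** In each degree both sides become sums over triples of block sizes, and [shuf_assoc] identifies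
    the summands. *)
Lemma starA f g h : star Rc q (star Rc q f g) h = star Rc q f (star Rc q g h).
Proof.
apply: functional_extensionality => w; rewrite !starE.
pose G j i l := shuf (j + i + l) j (i + l) 0 (shuf (j + i + l) i l j (tpr (j + i) l (tpr j i f g) h)) w.
transitivity (\sum_(k < (size w).+1) \sum_(j < k.+1) G j (k - j)%N (size w - k)%N).
  apply: eq_bigr => k _; have hk : (k <= size w)%N by rewrite -ltnS.
  have -> : tpr k (size w - k) (star Rc q f g) h =
      fun z => \sum_(j < k.+1) 1 * shuf (k + (size w - k)) j (k - j) 0
                 (tpr k (size w - k) (tpr j (k - j) f g) h) z.
    apply: functional_extensionality => z; rewrite {1}/tpr; case: eqP => hz; last first.
      by rewrite big1 // => j _; rewrite homog_shuf ?mulr0 //; [exact: homog_tpr | apply/eqP].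
    rewrite starE size_takel; last by lia.
    rewrite mulr_suml; apply: eq_bigr => j _; have hj : (j <= k)%N by rewrite -ltnS.
    rewrite -tpr_shuf_l; last by lia.
    by rewrite /tpr hz eqxx mul1r.
  rewrite linear_op_sum; last by apply: shuf_lin; lia.
  apply: eq_bigr => j _; rewrite mul1r /G; have hj : (j <= k)%N by rewrite -ltnS.
  have := @shuf_assoc _ _ Rc q heckeR (size w) j (k - j) (size w - k) 0
    (tpr k (size w - k) (tpr j (k - j) f g) h).
  by rewrite add0n !subnKC // => -> //; lia.
rewrite sum_triangle; apply: eq_bigr => j _; have hj : (j <= size w)%N by rewrite -ltnS.
have -> : tpr j (size w - j) f (star Rc q g h) =
    fun z => \sum_(i < (size w - j).+1) 1 * shuf (j + (size w - j)) i (size w - j - i) j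
               (tpr j (size w - j) f (tpr i (size w - j - i) g h)) z.
  apply: functional_extensionality => z; rewrite {1}/tpr; case: eqP => hz; last first.
    by rewrite big1 // => i _; rewrite homog_shuf ?mulr0 //; [exact: homog_tpr | apply/eqP].
  have sz : size (drop j z) = (size w - j)%N by rewrite size_drop hz; lia.
  rewrite starE sz mulr_sumr; apply: eq_bigr => i _; have hi : (i <= size w - j)%N by rewrite -ltnS.
  have := @tpr_shuf_r _ _ Rc q j (size w - j) i (size w - j - i) 0 f (tpr i (size w - j - i) g h).
  rewrite addn0 => <-; last by lia.
  by rewrite /tpr hz eqxx mul1r.
rewrite linear_op_sum; last by apply: shuf_lin; lia.
apply: eq_bigr => i _; rewrite mul1r /G; have hi : (i <= size w - j)%N by rewrite -ltnS.
have e1 : (j + i + (size w - j - i) = size w)%N by lia.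
have e2 : (i + (size w - j - i) = size w - j)%N by lia.
by rewrite tprA e1 e2 subnKC.
Qed.

End Products.

(** * Finite sums over words and basis tensors *)

Section Words.
Variables (K : fieldType) (d : nat).
Local Notation tens := (tens K d).
Implicit Types (f g h : tens) (u v w : seq 'I_d) (F : tens -> tens).

Fixpoint words (p : nat) : seq (seq 'I_d) :=
  if p is p'.+1 then [seq a :: w | a <- enum 'I_d, w <- words p'] else [:: [::]].

Lemma mem_words p w : (w \in words p) = (size w == p).
Proof.
elim: p w => [|p IH] w /=; first by rewrite inE; case: w.
apply/allpairsP/idP => [[[a v] /= [_]]|]; first by rewrite IH => /eqP <- ->.
by case: w => // a w hw; exists (a, w); rewrite /= mem_enum IH.
Qed.

Lemma uniq_words p : uniq (words p).
Proof.
elim: p => //= p IH; apply: allpairs_uniq => //; first exact: enum_uniq.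
by move=> [a v] [b w] _ _ [-> ->].
Qed.

Lemma sum_words_cat a b (F : seq 'I_d -> K) :
  \sum_(w <- words (a + b)) F w = \sum_(u <- words a) \sum_(v <- words b) F (u ++ v).
Proof.
elim: a F => [|a IH] F; first by rewrite big_seq1.
rewrite addSn /= !big_allpairs_dep; apply: eq_bigr => x _.
by rewrite (IH (fun w => F (x :: w))).
Qed.

Lemma sum_words_eq p (F G : seq 'I_d -> K) : (forall w, size w = p -> F w = G w) ->
  \sum_(w <- words p) F w = \sum_(w <- words p) G w.
Proof. by move=> e; apply: eq_big_seq => w; rewrite mem_words => /eqP; apply: e. Qed.

Definition dlt v : tens := fun w => (w == v)%:R.

Lemma sum_dlt p v (F : seq 'I_d -> K) : size v = p -> \sum_(w <- words p) dlt v w * F w = F v.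
Proof.
move=> sv; rewrite (bigD1_seq v) ?uniq_words ?mem_words ?sv //= /dlt eqxx mul1r.
by rewrite big1 ?addr0 // => w /negbTE->; rewrite mul0r.
Qed.

Lemma homog_dlt v : homog (size v) (dlt v).
Proof. by move=> w hw; rewrite /dlt; case: (w =P v) hw => [->|//]; rewrite eqxx. Qed.

Lemma sum_dltr p v (F : seq 'I_d -> K) : size v = p -> \sum_(w <- words p) F w * dlt w v = F v.
Proof.
move=> sv; rewrite -[RHS](sum_dlt F sv); apply: eq_bigr => w _.
by rewrite /dlt eq_sym mulrC.
Qed.

End Words.

(** * The top degree of Ups *)

Section TopDegree.
Variables (K : fieldType) (d : nat) (Rc : 'I_d -> 'I_d -> 'I_d -> 'I_d -> K) (q : K).
Local Notation tens := (tens K d).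
Local Notation shuf := (shuf Rc q).
Local Notation cross := (cross Rc q).
Local Notation Im := (Im Rc q).
Local Notation Ups := (Ups Rc q).
Implicit Types (f g h x : tens) (u v w y : seq 'I_d).

Lemma Ups_ctr u p f : Ups (size u + p) f -> Ups p (ctr u f).
Proof.
move=> /UpsP[hf If]; apply/UpsP; split=> [w hw|j hj].
  by rewrite /ctr hf // size_cat eqn_add2l.
by apply: Im_ctr => //; apply: If; lia.
Qed.

Lemma Ups_ctrr v p f : Ups (p + size v) f -> Ups p (ctrr v f).
Proof.
move=> /UpsP[hf If]; apply/UpsP; split=> [w hw|j hj].
  by rewrite /ctrr hf // size_cat eqn_add2r.
by apply: Im_ctrr => //; apply: If; lia.
Qed.

Lemma ctr_tpr a b l f g u : size u = a -> ctr u (tpr (a + b) l f g) = tpr b l (ctr u f) g.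
Proof.
move=> su; apply: functional_extensionality => w.
rewrite /ctr /tpr size_cat su -addnA eqn_add2l take_cat drop_cat su.
by rewrite ltnNge leq_addr /= addKn.
Qed.

Lemma Ups_tlin p a f b g : Ups p f -> Ups p g -> Ups p (tlin a f b g).
Proof.
move=> /UpsP[hf If] /UpsP[hg Ig]; apply/UpsP; split; first exact: homog_tlin.
by move=> j hj; apply: Im_lin => //; [exact: If | exact: Ig].
Qed.

Lemma Ups_above n p f : zero_sp (Ups n.+1) -> (n < p)%N -> Ups p f -> f = @tzero K d.
Proof.
move=> Un1 h /UpsP[hf If]; apply: (Ups_vanish (a := 0) Un1 h hf) => j _ hj.
by apply: If; lia.
Qed.

Hypothesis heckeR : hecke Rc q.

Lemma Ups_shuf k l f g : Ups k f -> Ups l g -> Ups (k + l) (shuf (k + l) k l 0 (tpr k l f g)).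
Proof.
move=> Uf Ug; apply/UpsP; split=> [|j hj]; first by apply: homog_shuf; apply: homog_tpr.
by apply: (Im_shuf heckeR) => // e _ he ne; apply: Im_tpr.
Qed.

Variables (n : nat) (om : tens) (y0 : seq 'I_d).
Hypotheses (Uom : Ups n om) (om0 : om y0 != 0)
  (gen : forall f, Ups n f -> exists c : K, forall w, f w = c * om w).

(** Evaluation at [y0] identifies Ups(n) with the ground field. *)
Lemma Ups_top f w : Ups n f -> f w = f y0 / om y0 * om w.
Proof. by move=> /gen[c e]; rewrite !e mulfK. Qed.

Lemma size_top : size y0 = n.
Proof.
case: Uom => h _; apply/eqP; apply: contraNT om0 => ne; by rewrite h.
Qed.

Lemma tpr_om_eq0 k x : homog k x -> tpr n k om x = @tzero K d -> x = @tzero K d.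
Proof.
move=> hx e; apply: (@tens_ext _ _ k) => w hw; last by rewrite hx.
have := congr1 (@^~ (y0 ++ w)) e; rewrite tpr_cat // ?size_top // => /eqP.
by rewrite mulf_eq0 (negbTE om0) => /eqP.
Qed.

Lemma cross0 p a m k : (a + m + k <= p)%N -> cross p a m k (@tzero K d) = @tzero K d.
Proof.
move=> h; have e : @tzero K d = tlin 0 (@tzero K d) 0 (@tzero K d).
  by apply: functional_extensionality => w; rewrite /tlin /tzero; ring.
rewrite {1}e cross_lin //; by apply: functional_extensionality => w; rewrite /tlin /tzero; ring.
Qed.

Section Vanishing.
Hypothesis Un1 : zero_sp (Ups n.+1).

Lemma star_nondeg k x : (k <= n)%N -> Ups k x ->
  (forall b, Ups (n - k) b -> shuf n (n - k) k 0 (tpr (n - k) k b x) y0 = 0) ->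
  x = @tzero K d.
Proof.
move=> hk Ux h; have [c c0 hc] := shuf_cross heckeR Un1 hk.
have [hx _] := Ux; apply: (tpr_om_eq0 hx).
have hf : homog (n + k) (tpr n k om x) := @homog_tpr _ _ n k om x.
have E := hc 0 (n + k)%N _ (leqnn _) hf.
have {}E : shuf (n + k) (n - k) k k (tpr n k om x) = tlin c (cross (n + k) 0 n k (tpr n k om x)) 0 (tpr n k om x).
  by apply: E => j _ hj nj; apply: Im_tpr.
(* Contracting the first [k] factors by [y] leaves the product of [ctr y om], an element of
   Ups(n-k), with [x]. It lies in Ups(n), where one zero coefficient at [y0] forces vanishing. *)
have Z : shuf (n + k) (n - k) k k (tpr n k om x) = @tzero K d.
  apply: (@tens_ext _ _ (n + k)) => w hw; last by rewrite homog_shuf.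
  rewrite addnC in hw; have [y [z [-> sy sz]]] := size_split hw.
  have Uy : Ups (n - k) (ctr y om) by apply: Ups_ctr; rewrite sy subnKC.
  have := @ctr_shuf _ _ Rc q y n (n - k) k 0 (tpr n k om x).
  rewrite sy addn0 [(k + n)%N]addnC -[in tpr n k](subnKC hk) ctr_tpr // => /(_ _)/(congr1 (@^~ z)).
  rewrite {1}/ctr => -> //; last by lia.
  have Us : Ups n (shuf n (n - k) k 0 (tpr (n - k) k (ctr y om) x)).
    by have := Ups_shuf Uy Ux; rewrite subnK.
  by rewrite (Ups_top z Us) h // !mul0r.
apply: (@cross_inj _ _ _ _ heckeR (n + k) 0 n k); first by [].
rewrite cross0 //; apply: functional_extensionality => w.
have := congr1 (@^~ w) (etrans (esym E) Z); rewrite /tlin mul0r addr0 => /eqP.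
by rewrite mulf_eq0 (negbTE c0) => /eqP.
Qed.

(* [x (x) om] is the braiding of some [om (x) x'], to which [shuf_cross] applies. *)
Lemma Ups_contraction k x : (k <= n)%N -> Ups k x -> exists coef : seq 'I_d -> K,
  forall y, size y = k -> x y = \sum_(v <- words d (n - k)) coef v * om (y ++ v).
Proof.
move=> hk Ux; have [c c0 hc] := shuf_cross heckeR Un1 hk.
pose f := tpr k n x om.
have hf : homog (n + k) f by rewrite addnC; apply: homog_tpr.
have [z [ez hz]] := cross_surj heckeR f (leqnn (0 + n + k)); have {}hz := hz hf.
have Iz j : (j.+1 < n + k)%N -> j.+1 != n -> Im (n + k) j z.
  move=> hj nj; apply: (Im_cross_inv heckeR (leqnn (0 + n + k))) => // e _ he ne.
  by rewrite ez /f addnC; apply: Im_tpr => //; rewrite addnC.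
have E : shuf (n + k) (n - k) k k z = tlin c f 0 z.
  by rewrite -ez; apply: (hc 0) => // j _; apply: Iz.
(* Every contraction of the last [k] factors of [z] lies in Ups(n), hence is a multiple of [om];
   [x'] collects these multiples. *)
pose x' : tens := fun v => if size v == k then z (y0 ++ v) / om y0 else 0.
have zE u v : size u = n -> size v = k -> z (u ++ v) = om u * x' v.
  move=> su sv; rewrite -[LHS]/(ctrr v z u) (Ups_top u) /ctrr; last first.
    apply/UpsP; split=> [w hw|j hj]; first by rewrite /ctrr hz // size_cat sv eqn_add2r.
    by apply: Im_ctrr => //; rewrite sv; apply: Iz; lia.
  by rewrite /x' sv eqxx; ring.
(* Expanding [ctr y z] as the sum of om(yv) e_v (x) x' and reading the shuffle at [y0] must give c
   x(y) om(y0). *)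
exists (fun v => shuf n (n - k) k 0 (tpr (n - k) k (dlt K v) x') y0 / (c * om y0)) => y sy.
have S := @ctr_shuf _ _ Rc q y n (n - k) k 0 z.
rewrite sy addn0 [(k + n)%N]addnC in S; have {}S := congr1 (@^~ y0) (S _).
have e1 : c * x y * om y0 = shuf n (n - k) k 0 (ctr y z) y0.
  rewrite -S; last by lia.
  by rewrite /ctr E /tlin /f tpr_cat ?size_top //; ring.
have e2 : forall w, size w = n -> ctr y z w = \sum_(v <- words d (n - k)) om (y ++ v) * tpr (n - k) k (dlt K v) x' w.
  move=> w hw; have hw' : size w = (n - k + k)%N by lia.
  have [s [t [-> ss st]]] := size_split hw'.
  rewrite /ctr catA zE // ?size_cat; try lia.
  rewrite -(sum_dltr (fun s => om (y ++ s)) ss) mulr_suml; apply: eq_bigr => v _.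
  by rewrite tpr_cat // mulrA.
have e3 : shuf n (n - k) k 0 (ctr y z) y0 =
    \sum_(v <- words d (n - k)) om (y ++ v) * shuf n (n - k) k 0 (tpr (n - k) k (dlt K v) x') y0.
  rewrite -(congr1 (@^~ y0) (linear_op_sum _ _ _ _)); last by apply: shuf_lin; lia.
  congr (shuf _ _ _ _ _ _); apply: (@tens_ext _ _ n) => // w hw.
  rewrite /ctr hz ?size_cat ?sy; last by lia.
  by rewrite big1 // => v _; rewrite homog_tpr ?mulr0 // subnK.
have -> : x y = c * x y * om y0 / (c * om y0) by field; rewrite c0 om0.
rewrite e1 e3 mulr_suml; apply: eq_bigr => v _; ring.
Qed.

End Vanishing.
End TopDegree.

(** * Vanishing above a one-dimensional component *)

Section TopDegreeVanishing.
Variables (K : fieldType) (d : nat) (Rc : 'I_d -> 'I_d -> 'I_d -> 'I_d -> K) (q : K).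
Local Notation tens := (tens K d).
Local Notation chain := (chain Rc q).
Local Notation shuf := (shuf Rc q).
Local Notation Ups := (Ups Rc q).
Hypothesis heckeR : hecke Rc q.

Lemma Ups_dlt1 (a : 'I_d) : Ups 1 (dlt K [:: a]).
Proof. by apply/UpsP; split=> [|j]; first exact: (@homog_dlt K d [:: a]). Qed.

(* A nonzero [u] in Ups(n+1) is both [om (x) v] and [v' (x) om], so [v'] is the only
   possible first tensor factor of [om] and all the [R_1 ... R_n (om (x) e_x)] are
   proportional to [u]; this contradicts invertibility of [R] when [d > 1]. *)
Lemma dim1_vanish n : (0 < n)%N -> (1 < d)%N -> dim1 (Ups n) -> zero_sp (Ups n.+1).
Proof.
case: n => // m _ hd [om [Uom [y0 om0] gen]] u Uu w0.
set n := m.+1 in Uom gen Uu *.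
have [//|u0] := eqVneq (u w0) 0; exfalso.
have sy0 : size y0 = n := size_top Uom om0.
have tailE t : Ups n.+1 t -> forall e y, t (y ++ [:: e]) = t (y0 ++ [:: e]) / om y0 * om y.
  by move=> Ut e y; apply: (Ups_top om0 gen (f := ctrr [:: e] t)); apply: Ups_ctrr; rewrite addn1.
have headE t : Ups n.+1 t -> forall a y, t (a :: y) = t (a :: y0) / om y0 * om y.
  by move=> Ut a y; apply: (Ups_top om0 gen (f := ctr [:: a] t)); apply: Ups_ctr; rewrite add1n.
pose hd_ t a := t (a :: y0) / om y0; pose tl_ t e := t (y0 ++ [:: e]) / om y0.
have sw0 : size w0 = n.+1.
  by case: Uu => h _; apply/eqP; apply: contraNT u0 => ne; rewrite h.
have [e ue] : exists e, tl_ u e != 0.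
  case/lastP: w0 u0 sw0 => // w e; rewrite -cats1 (tailE _ Uu) => h _; exists e.
  by apply: contraNneq h => h0; rewrite -/(tl_ u e) h0 mul0r.
(* Reading [u] at [a :: y ++ [:: e]] through its head and through its tail expresses [om] as v' (x)
   [om'], with v' given by [hd_ u]. *)
pose om' : tens := tlin (tl_ u e)^-1 (ctrr [:: e] om) 0 om.
have Uom' : Ups m om'.
  have Uc : Ups m (ctrr [:: e] om) by apply: Ups_ctrr; rewrite addn1.
  have -> : om' = tlin (tl_ u e)^-1 (ctrr [:: e] om) 0 (ctrr [:: e] om).
    by apply: functional_extensionality => w; rewrite /om' /tlin; ring.
  exact: Ups_tlin.
have omE a y : om (a :: y) = hd_ u a * om' y.
  rewrite /om' /tlin mul0r addr0 /ctrr.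
  have := tailE _ Uu e (a :: y); rewrite cat_cons (headE _ Uu) -/(tl_ u e) -/(hd_ u a) => h.
  by apply: (mulfI ue); rewrite -h; field.
have [y1 [e1 ey0]] : exists y1 e1, y0 = y1 ++ [:: e1].
  by case/lastP: (y0) sy0 => // y1 e1 _; exists y1, e1; rewrite cats1.
(* The scalar comes from reading [t] at [a :: y1 ++ [:: e1]] in both ways; thus [u] spans
   Ups(n+1). *)
have prop t : Ups n.+1 t -> exists c, forall w, t w = c * u w.
  move=> Ut; pose c := om' y1 * tl_ t e1 / om y0; exists c => -[|a z].
    by case: Ut => -> //; case: Uu => -> //; rewrite mulr0.
  have ht : hd_ t a = c * hd_ u a.
    have := tailE _ Ut e1 (a :: y1); rewrite cat_cons (headE _ Ut) -ey0 -/(hd_ t a) -/(tl_ t e1) omE => h.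
    by apply: (mulIf om0); rewrite h /c; field.
  by rewrite (headE _ Ut) (headE _ Uu) -/(hd_ t a) -/(hd_ u a) ht mulrA.
pose T x := tpr n 1 om (dlt K [:: x]).
(* The shuffle avoids the first factor v' of [om], so it yields v' times an element of Ups(n), a
   multiple of v' (x) [om], that is, of [u]. *)
have step1 x : exists c, forall w, shuf n.+1 m 1 1 (T x) w = c * u w.
  have Um : Ups n (shuf n m 1 0 (tpr m 1 om' (dlt K [:: x]))).
    by have := Ups_shuf heckeR Uom' (Ups_dlt1 x); rewrite addn1.
  exists (shuf n m 1 0 (tpr m 1 om' (dlt K [:: x])) y0 / om y0) => -[|a z].
    rewrite homog_shuf //; last by have := @homog_tpr _ _ n 1 om (dlt K [:: x]); rewrite addn1.
    by case: Uu => -> //; rewrite mulr0.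
  have := @ctr_shuf _ _ Rc q [:: a] n m 1 0 (T x); rewrite /= add1n addn0 => S.
  have {}S : ctr [:: a] (shuf n.+1 m 1 1 (T x)) = shuf n m 1 0 (ctr [:: a] (T x)) by apply: S; lia.
  rewrite -[LHS]/(ctr [:: a] (shuf n.+1 m 1 1 (T x)) z) S.
  rewrite (@ctr_tpr _ _ 1 m 1 om (dlt K [:: x]) [:: a]) //.
  have -> : ctr [:: a] om = tlin (hd_ u a) om' 0 om'.
    by apply: functional_extensionality => y; rewrite /ctr /tlin /= omE; ring.
  rewrite tpr_linl shuf_lin /tlin; last by lia.
  by rewrite (headE _ Uu) -/(hd_ u a) (Ups_top om0 gen z Um); ring.
(* The first-factor recursion for the product of [om] with e_x contains the chain; the other two
   terms are multiples of [u] by [step1] and [prop]. *)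
have step2 x : exists c, forall w, chain n.+1 0 n (T x) w = c * u w.
  have [c1 h1] := step1 x.
  have U2 : Ups n.+1 (shuf n.+1 n 1 0 (T x)).
    by have := Ups_shuf heckeR Uom (Ups_dlt1 x); rewrite addn1.
  have [c2 h2] := prop _ U2.
  exists ((-1) ^+ n * (c2 - q * c1)) => w.
  have := h2 w; rewrite shufS shuf0r /tlin h1 expr1 => h.
  have s2 : (-1) ^+ n * (-1) ^+ n = 1 :> K by rewrite -expr2 sqrr_sign.
  have h' : (-1) ^+ n * chain n.+1 0 n (T x) w = c2 * u w - q * (c1 * u w) by rewrite -h; ring.
  transitivity ((-1) ^+ n * (-1) ^+ n * chain n.+1 0 n (T x) w); first by rewrite s2 mul1r.
  by rewrite -mulrA h'; ring.
have homT x : homog n.+1 (T x).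
  by have := @homog_tpr _ _ n 1 om (dlt K [:: x]); rewrite addn1.
pose x1 := Ordinal (ltnW hd); pose x2 := Ordinal hd.
have [c1 h1] := step2 x1; have [c2 h2] := step2 x2.
have d0 a : ~ (dlt K [:: a] = @tzero K d).
  by move/(congr1 (@^~ [:: a])); rewrite /dlt eqxx /tzero => /eqP; rewrite oner_eq0.
have inj v : homog 1 v -> chain n.+1 0 n (tpr n 1 om v) = @tzero K d -> v = @tzero K d.
  move=> hv h; apply: (tpr_om_eq0 Uom om0 hv).
  have /(can_inj) := @chainK _ _ _ _ heckeR n.+1 0 n (ltnSn _); apply; rewrite h.
  have e0 : @tzero K d = tlin 0 (@tzero K d) 0 (@tzero K d).
    by apply: functional_extensionality => w; rewrite /tlin /tzero; ring.
  by rewrite {2}e0 chain_lin //; apply: functional_extensionality => w; rewrite /tlin /tzero; ring.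
have hdl (a : 'I_d) : homog 1 (dlt K [:: a]) := @homog_dlt K d [:: a].
have lin0 : tlin c2 (dlt K [:: x1]) (- c1) (dlt K [:: x2]) = @tzero K d.
  apply: inj; first exact: homog_tlin.
  rewrite tpr_linr chain_lin //; apply: functional_extensionality => w.
  by rewrite /tlin h1 h2 /tzero; ring.
have c20 : c2 = 0.
  have := congr1 (@^~ [:: x1]) lin0; rewrite /tlin /dlt /tzero eqxx.
  by rewrite (_ : [:: x1] == [:: x2] = false) //= mulr0 addr0 mulr1.
apply: (d0 x2); apply: inj => //; apply: functional_extensionality => w.
by rewrite h2 c20 mul0r.
Qed.

End TopDegreeVanishing.

(** * One-sided nondegeneracy *)

Section Gram.
Variables (K : fieldType) (d : nat).
Local Notation tens := (tens K d).
Variables (A I : tens -> Prop) (B : tens -> tens -> K) (n : nat) (e : 'I_n -> tens).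
Hypotheses (A0 : A (@tzero K d))
  (Alin : forall x f y g, A f -> A g -> A (tlin x f y g))
  (Ae : forall i, A (e i))
  (span : forall f, A f -> exists c : 'I_n -> K, I (fun w => f w - \sum_(i < n) c i * e i w))
  (Blin : forall a b c x y, A a -> A b -> A c ->
     B (tlin x a y b) c = x * B a c + y * B b c /\ B c (tlin x a y b) = x * B c a + y * B c b)
  (BI : forall a b, A a -> A b -> I a -> B a b = 0 /\ B b a = 0).

Definition comb (c : 'I_n -> K) : tens := fun w => \sum_(i < n) c i * e i w.

Lemma bilin_comb c : A (comb c) /\ forall a, A a ->
  B a (comb c) = \sum_(i < n) c i * B a (e i) /\ B (comb c) a = \sum_(i < n) c i * B (e i) a.
Proof.
rewrite /comb; elim: (index_enum _) => [|i s [IH1 IH2]].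
  have -> : (fun w => \sum_(i <- [::]) c i * e i w) = @tzero K d.
    by apply: functional_extensionality => w; rewrite big_nil.
  split=> // a Aa; rewrite !big_nil.
  have e0 : @tzero K d = tlin 0 (@tzero K d) 0 (@tzero K d).
    by apply: functional_extensionality => w; rewrite /tlin /tzero; ring.
  by have [h1 h2] := Blin 0 0 A0 A0 Aa; rewrite e0 h1 h2; split; ring.
have -> : (fun w => \sum_(i <- i :: s) c i * e i w) = tlin (c i) (e i) 1 (fun w => \sum_(i <- s) c i * e i w).
  by apply: functional_extensionality => w; rewrite big_cons /tlin mul1r.
split=> [|a Aa]; first exact: Alin.
have [h1 h2] := Blin (c i) 1 (Ae i) IH1 Aa; have [h3 h4] := IH2 a Aa.
by rewrite h1 h2 h3 h4 !big_cons !mul1r.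
Qed.

Lemma bilin_span f : A f -> exists c, forall a, A a ->
  B a f = B a (comb c) /\ B f a = B (comb c) a.
Proof.
move=> Af; have [c hc] := span Af; exists c => a Aa; have [Ac _] := bilin_comb c.
have -> : f = tlin 1 (tlin 1 f (-1) (comb c)) 1 (comb c).
  by apply: functional_extensionality => w; rewrite /tlin; ring.
have Ad : A (tlin 1 f (-1) (comb c)) by apply: Alin.
have ed : tlin 1 f (-1) (comb c) = fun w => f w - \sum_(i < n) c i * e i w.
  by apply: functional_extensionality => w; rewrite /tlin /comb; ring.
have Id : I (tlin 1 f (-1) (comb c)) by rewrite ed.
have [h1 h2] := Blin 1 1 Ad Ac Aa; have [h3 h4] := BI Ad Aa Id.
by rewrite h1 h2 h3 h4; split; ring.
Qed.

(** A witness is sought among the finitely many spanning elements, where the search is decidable, so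
    no excluded middle is needed. *)
Lemma nondeg_witness : (forall a, A a -> (forall b, A b -> B a b = 0) -> I a) ->
  forall a, A a -> ~ I a -> exists b, A b /\ B a b != 0.
Proof.
move=> nd a Aa nIa; have [/existsP[i hi]|/existsPn h] := boolP [exists i, B a (e i) != 0].
  by exists (e i).
case: nIa; apply: nd => // b Ab; have [c hc] := bilin_span Ab.
have [-> _] := hc a Aa; have [_ /(_ a Aa)[-> _]] := bilin_comb c.
by rewrite big1 // => i _; have := h i; rewrite negbK => /eqP->; rewrite mulr0.
Qed.

(* The Gram matrix of a spanning family is square, so its left and right kernels have the
   same dimension; both contain the relations modulo [I]. *)
Lemma nondeg_sym : (forall a, A a -> (forall b, A b -> B a b = 0) -> I a) ->
  forall b, A b -> (forall a, A a -> B a b = 0) -> I b.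
Proof.
move=> nd b Ab hb; apply: (nd) => // b' Ab'.
have [c hc] := bilin_span Ab; have [_ ->] := hc b' Ab'.
pose G := \matrix_(i < n, j < n) B (e i) (e j).
(* A row killing [G] from the left is a combination orthogonal to everything on its right, hence in
   [I] by [nd], hence orthogonal on the other side as well. Equal ranks then reverse the
   inclusion. *)
have sub : (kermx G <= kermx G^T)%MS.
  apply/sub_kermxP/row_matrixP => k; rewrite row_mul row0.
  set u := row k (kermx G); have uG : u *m G = 0 by rewrite /u -row_mul mulmx_ker row0.
  pose cu i := u 0 i; have [Ac hcu] := bilin_comb cu.
  have Iu : I (comb cu).
    apply: (nd) => // f Af; have [cf hf] := bilin_span Af.
    have [-> _] := hf _ Ac; have [_ hcf] := bilin_comb cf; have [-> _] := hcf _ Ac.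
    rewrite big1 // => j _; have [_ ->] := hcu _ (Ae j).
    have := congr1 (fun M : 'rV_n => M 0 j) uG; rewrite mxE [RHS]mxE => e0.
    rewrite (_ : \sum_(i < n) _ = 0) ?mulr0 // -[RHS]e0.
    by apply: eq_bigr => i _; rewrite [G _ _]mxE.
  apply/rowP => j; rewrite [RHS]mxE -[RHS](proj2 (BI Ac (Ae j) Iu)) (proj1 (hcu _ (Ae j))) mxE.
  by apply: eq_bigr => i _; rewrite [G^T _ _]mxE [G _ _]mxE.
have sub' : (kermx G^T <= kermx G)%MS.
  have /leqifP := mxrank_leqif_sup sub; rewrite !mxrank_ker mxrank_tr.
  by case: ifP => //; rewrite ltnn.
pose u := \row_(i < n) c i.
have /sub_kermxP uGT : u *m G^T = 0.
  apply/rowP => j; rewrite [RHS]mxE -[RHS](hb _ (Ae j)) (proj1 (hc _ (Ae j))).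
  rewrite (proj1 (proj2 (bilin_comb c) _ (Ae j))) mxE.
  by apply: eq_bigr => i _; rewrite [G^T _ _]mxE [G _ _]mxE [u _ _]mxE.
have /sub_kermxP uG := submx_trans uGT sub'.
have [Ac hcc] := bilin_comb c; have [cf hf] := bilin_span Ab'.
have [-> _] := hf _ Ac; have [_ hcf] := bilin_comb cf; have [-> _] := hcf _ Ac.
rewrite big1 // => j _; have [_ ->] := hcc _ (Ae j).
have := congr1 (fun M : 'rV_n => M 0 j) uG; rewrite mxE [RHS]mxE => e0.
rewrite (_ : \sum_(i < n) _ = 0) ?mulr0 // -[RHS]e0.
by apply: eq_bigr => i _; rewrite [G _ _]mxE [u _ _]mxE.
Qed.

End Gram.

(** * The ideal of the quadratic dual *)

Section Ideal.
Variables (K : fieldType) (d : nat) (G : tens K d -> Prop).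
Local Notation tens := (tens K d).

Lemma ideal0 : ideal G (@tzero K d). Proof. by move=> P. Qed.

Lemma ideal_tlin x f y g : ideal G f -> ideal G g -> ideal G (tlin x f y g).
Proof. by move=> hf hg P P0 Pl Pg Pm; apply: (Pl); [apply: hf | apply: hg]. Qed.

Lemma ideal_gen f : G f -> ideal G f. Proof. by move=> hf P P0 Pl Pg Pm; apply: Pg. Qed.

Lemma ideal_tmul f x : ideal G f -> fsupp x -> ideal G (tmul x f) /\ ideal G (tmul f x).
Proof.
by move=> hf hx; split=> P P0 Pl Pg Pm; have [] := Pm f x (hf P P0 Pl Pg Pm) hx.
Qed.

Lemma ideal_sum (T : eqType) (s : seq T) (c : T -> K) (F : T -> tens) :
  (forall i, i \in s -> ideal G (F i)) -> ideal G (fun w => \sum_(i <- s) c i * F i w).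
Proof.
elim: s => [|i s IH] hF.
  rewrite (_ : (fun _ => _) = @tzero K d); first exact: ideal0.
  by apply: functional_extensionality => w; rewrite big_nil.
rewrite (_ : (fun _ => _) = tlin (c i) (F i) 1 (fun w => \sum_(i <- s) c i * F i w)).
  apply: ideal_tlin; first by apply: hF; rewrite mem_head.
  by apply: IH => j hj; apply: hF; rewrite inE hj orbT.
by apply: functional_extensionality => w; rewrite big_cons /tlin mul1r.
Qed.

End Ideal.

(** * The ideal as the annihilator of Ups *)

Section Perp.
Variables (K : fieldType) (d : nat) (Rc : 'I_d -> 'I_d -> 'I_d -> 'I_d -> K) (q : K).
Local Notation tens := (tens K d).
Local Notation r := (braid_op Rc q).
Local Notation Im := (Im Rc q).
Local Notation Ups := (Ups Rc q).
Local Notation words := (words d).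
Local Notation dlt := (dlt K).
Implicit Types (f g h x phi : tens) (u v w : seq 'I_d).

Definition pairing (p : nat) phi x : K := \sum_(w <- words p) phi w * x w.

(** [ideal_perp] and [ideal_of_perp_all] show that the finitely supported members are exactly the
    ideal, so the quadratic dual in degree p is the dual of Ups(p). *)
Definition perp_all phi := forall p x, Ups p x -> pairing p phi x = 0.

Lemma pairing_linl p a f b g x : pairing p (tlin a f b g) x = a * pairing p f x + b * pairing p g x.
Proof.
rewrite /pairing !mulr_sumr -big_split; apply: eq_bigr => w _; rewrite /tlin /=; ring.
Qed.

Lemma pairing_eql p f g x : (forall w, size w = p -> f w = g w) -> pairing p f x = pairing p g x.
Proof. by move=> e; apply: sum_words_eq => w hw; rewrite e. Qed.

Lemma pairing_homog p m f x : homog m f -> p != m -> pairing p f x = 0.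
Proof.
move=> hf ne; rewrite /pairing big_seq big1 // => w; rewrite mem_words => /eqP hw.
by rewrite hf ?mul0r // hw.
Qed.

Lemma sum_words1 (F : seq 'I_d -> K) : \sum_(w <- words 1) F w = \sum_(a : 'I_d) F [:: a].
Proof.
rewrite -[words 1]/[seq a :: w | a <- enum 'I_d, w <- words 0] big_allpairs_dep big_enum.
by apply: eq_bigr => a _; rewrite big_seq1.
Qed.

Lemma pairing2 f x : pairing 2 f x = \sum_(a : 'I_d) \sum_(b : 'I_d) f [:: a; b] * x [:: a; b].
Proof.
rewrite /pairing (@sum_words_cat _ _ 1 1) sum_words1; apply: eq_bigr => a _.
exact: sum_words1.
Qed.

Lemma pairing_tmul p f g x : pairing p (tmul f g) x =
  \sum_(i < p.+1) \sum_(u <- words i) \sum_(v <- words (p - i)) f u * g v * x (u ++ v).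
Proof.
transitivity (\sum_(i < p.+1) \sum_(w <- words p) f (take i w) * g (drop i w) * x w).
  rewrite exchange_big; apply: sum_words_eq => w hw.
  by rewrite /tmul hw mulr_suml.
apply: eq_bigr => i _; have hi : (i <= p)%N by rewrite -ltnS.
rewrite -{1}(subnKC hi) sum_words_cat; apply: sum_words_eq => u hu; apply: sum_words_eq => v hv.
by rewrite -hu take_size_cat // drop_size_cat.
Qed.

(** Contraction of leading factors preserves Ups, so the annihilator absorbs left factors; trailing
    factors give the other side. *)
Lemma perp_tmull f g : perp_all g -> perp_all (tmul f g).
Proof.
move=> hg p x Ux; rewrite pairing_tmul big1 // => i _; have hi : (i <= p)%N by rewrite -ltnS.
rewrite big_seq big1 // => u; rewrite mem_words => /eqP hu.
transitivity (f u * pairing (p - i) g (ctr u x)).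
  by rewrite /pairing mulr_sumr; apply: eq_bigr => v _; rewrite mulrA.
by rewrite hg ?mulr0 //; apply: Ups_ctr; rewrite hu subnKC.
Qed.

Lemma perp_tmulr f g : perp_all g -> perp_all (tmul g f).
Proof.
move=> hg p x Ux; rewrite pairing_tmul big1 // => i _; have hi : (i <= p)%N by rewrite -ltnS.
rewrite exchange_big big_seq big1 // => v; rewrite mem_words => /eqP hv.
transitivity (f v * pairing i g (ctrr v x)).
  by rewrite /pairing mulr_sumr; apply: eq_bigr => u _; rewrite /ctrr; ring.
by rewrite hg ?mulr0 //; apply: Ups_ctrr; rewrite hv subnKC.
Qed.

Lemma ideal_perp f : ideal (perp2 Rc q) f -> perp_all f.
Proof.
apply.
- by move=> p x _; rewrite /pairing big1 // => w _; rewrite mul0r.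
- by move=> g h a b hg hh p x Ux; rewrite pairing_linl hg // hh // !mulr0 addr0.
- move=> g [hg h] p x Ux; have [ep|ne] := eqVneq p 2; last exact: (pairing_homog _ hg).
  by subst p; rewrite pairing2 h.
- by move=> g x hg _; split; [apply: perp_tmull | apply: perp_tmulr].
Qed.

Lemma fsupp_homog p f : homog p f -> fsupp f.
Proof. by move=> hf; exists p.+1 => w hw; rewrite hf //; apply/eqP; lia. Qed.

Lemma fsupp_dlt v : fsupp (dlt v).
Proof. by apply: (fsupp_homog (p := size v)); apply: homog_dlt. Qed.

Lemma dlt_expand p f : homog p f -> f = fun w => \sum_(v <- words p) f v * dlt v w.
Proof.
move=> hf; apply: (@tens_ext _ _ p) => w hw; first by rewrite sum_dltr.
rewrite hf // big_seq big1 // => v; rewrite mem_words => /eqP hv.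
by rewrite homog_dlt ?mulr0 // hv.
Qed.

Lemma comp_homog p f : homog p f -> Defs.comp p f = f.
Proof.
move=> hf; apply: functional_extensionality => w; rewrite /Defs.comp.
by case: eqP => // /eqP /hf.
Qed.

Lemma tmul_homog k l f g : homog k f -> homog l g -> tmul f g = tpr k l f g.
Proof. by move=> hf hg; rewrite -tmul_comp !comp_homog. Qed.

(* A functional annihilating the image of [R_j - q] on V^{** p} is a combination of
   products [e*_u . psi . e*_s] with [psi] in the annihilator of Ups(2). *)
Lemma ideal_of_perp_Im p j phi : (j.+1 < p)%N -> homog p phi ->
  (forall x, homog p x -> Im p j x -> pairing p phi x = 0) -> ideal (perp2 Rc q) phi.
Proof.
move=> hj hphi h; pose l := (p - j.+2)%N; have ep : p = (j + (2 + l))%N by lia.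
pose psi u s : tens := fun w => if size w == 2 then phi (u ++ w ++ s) else 0.
have hpsi u s : homog 2 (psi u s) by move=> w /negbTE hw; rewrite /psi hw.
have tE u s : size u = j -> size s = l ->
    tmul (dlt u) (tmul (psi u s) (dlt s)) = tpr j (2 + l) (dlt u) (tpr 2 l (psi u s) (dlt s)).
  move=> su ss; have hs : homog l (dlt s) by rewrite -ss; apply: homog_dlt.
  have hu : homog j (dlt u) by rewrite -su; apply: homog_dlt.
  by rewrite (tmul_homog (hpsi u s) hs) (tmul_homog hu (@homog_tpr _ _ _ _ _ _)).
have E : phi = fun w => \sum_(u <- words j) 1 *
    (fun w => \sum_(s <- words l) 1 * tmul (dlt u) (tmul (psi u s) (dlt s)) w) w.
  apply: (@tens_ext _ _ p) => w hw.
    rewrite ep in hw; have [u0 [w' [ew su0 sw']]] := size_split hw.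
    have [x0 [s0 [ew' sx0 ss0]]] := size_split sw'.
    transitivity (\sum_(u <- words j) phi (u ++ w') * dlt u u0); first by rewrite sum_dltr // -ew.
    apply: sum_words_eq => u hu; rewrite mul1r ew' -(sum_dltr (fun s => phi (u ++ x0 ++ s)) ss0).
    rewrite mulr_suml; apply: sum_words_eq => s hs.
    by rewrite tE // ew tpr_cat // ew' tpr_cat // /psi sx0 eqxx; ring.
  rewrite hphi // big_seq big1 // => u; rewrite mem_words => /eqP hu.
  rewrite mul1r big_seq big1 // => s; rewrite mem_words => /eqP hs.
  by rewrite tE // homog_tpr ?mulr0 // -ep.
rewrite E; apply: ideal_sum => u; rewrite mem_words => /eqP su.
apply: ideal_sum => s; rewrite mem_words => /eqP ss.
apply: (proj1 (ideal_tmul _ (fsupp_dlt u))); apply: (proj2 (ideal_tmul _ (fsupp_dlt s))).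
apply: ideal_gen; split=> // x /UpsP[hx Ix]; rewrite -pairing2.
(* Surrounding [x] by basis tensors carries the image in degree 2 into that of R_j - q, and pairing
   [phi] with [F x] is pairing [psi u s] with [x]. *)
pose F x := tpr j (2 + l) (dlt u) (tpr 2 l x (dlt s)).
have IX : Im p j (F x).
  rewrite ep; apply: (Im_intertwine (p := 2) (j := 0) (F := F)); last exact: Ix.
    by move=> a f b g; rewrite /F tpr_linl tpr_linr.
  by move=> f; rewrite /F tpr_braid_op_l // tpr_braid_op_r // addn0.
rewrite -(h (F x)) //; last by rewrite ep; apply: homog_tpr.
rewrite /pairing ep sum_words_cat.
transitivity (\sum_(v <- words j) dlt u v * \sum_(y <- words 2) psi v s y * x y).
  by rewrite sum_dlt.
apply: sum_words_eq => v hv; rewrite sum_words_cat mulr_sumr; apply: sum_words_eq => y hy.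
transitivity (\sum_(t <- words l) dlt s t * (dlt u v * (psi v t y * x y))); first by rewrite sum_dlt.
apply: sum_words_eq => t ht; rewrite /F tpr_cat // ?size_cat ?hy ?ht // tpr_cat //.
by rewrite /psi hy eqxx; ring.
Qed.

(** In finite dimension the annihilator of an intersection of images is the sum of their
    annihilators, and [ideal_of_perp_Im] treats each summand. In coordinates the annihilator of the
    image of R_j - q is the kernel of the transpose of [M j]. *)
Lemma ideal_of_perp_homog p phi : homog p phi ->
  (forall x, Ups p x -> pairing p phi x = 0) -> ideal (perp2 Rc q) phi.
Proof.
move=> hphi hperp; pose N := size (words p).
pose wd (i : 'I_N) := nth [::] (words p) i.
have swd i : size (wd i) = p by apply/eqP; rewrite -mem_words mem_nth.
have sumN (F : seq 'I_d -> K) : \sum_(w <- words p) F w = \sum_(i < N) F (wd i).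
  by rewrite (big_nth [::]) big_mkord.
pose toT (x : 'rV[K]_N) : tens := fun w => \sum_(i < N) x 0 i * dlt (wd i) w.
pose toV (f : tens) : 'rV[K]_N := \row_i f (wd i).
have toTK f : homog p f -> toT (toV f) = f.
  move=> hf; rewrite [RHS](dlt_expand hf); apply: functional_extensionality => w.
  by rewrite sumN; apply: eq_bigr => i _; rewrite mxE.
have toVK (x : 'rV[K]_N) : toV (toT x) = x.
  apply/rowP => i; rewrite mxE /toT (bigD1 i) //= /dlt eqxx mulr1 big1 ?addr0 // => k nk.
  by rewrite nth_uniq ?uniq_words // val_eqE [i == k]eq_sym (negbTE nk) mulr0.
have homT (x : 'rV[K]_N) : homog p (toT x).
  by move=> w hw; rewrite /toT big1 // => i _; rewrite homog_dlt ?mulr0 // swd.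
have pairT (x y : 'rV[K]_N) : pairing p (toT x) (toT y) = \sum_(i < N) x 0 i * y 0 i.
  rewrite /pairing sumN; apply: eq_bigr => i _.
  have tv (z : 'rV[K]_N) : toT z (wd i) = z 0 i by rewrite -[in RHS](toVK z) mxE.
  by rewrite !tv.
pose L j f : tens := tlin 1 (r p j f) (- q) f.
pose M (j : 'I_p.-1) := \matrix_(a < N) toV (L j (dlt (wd a))).
have hj (j : 'I_p.-1) : (j.+1 < p)%N by have := ltn_ord j; lia.
have LM (j : 'I_p.-1) (x : 'rV[K]_N) : toT (x *m M j) = L j (toT x).
  have Llin : linear_op (L j).
    move=> a f b g; rewrite /L braid_op_lin //; apply: functional_extensionality => w.
    by rewrite /tlin; ring.
  rewrite -[RHS]toTK; last by apply: homog_tlin => //; apply: homog_braid_op.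
  congr toT; apply/rowP => i; rewrite !mxE /toT (linear_op_sum _ _ _ Llin).
  by apply: eq_bigr => k _; rewrite !mxE.
pose S := (\sum_(j < p.-1) kermx (M j)^T)%MS.
have /sub_sumsmxP[u eu] : (toV phi <= S)%MS.
  rewrite submxE; apply/eqP/rowP => c; rewrite [RHS]mxE.
  (* A vector killed by all of [S] lies in the row space of each [M j], so it defines an element of
     Ups(p), which [phi] annihilates. *)
  pose x := (col c (cokermx S))^T.
  have Ux : Ups p (toT x).
    apply/UpsP; split=> // j lt; have lt' : (j < p.-1)%N by lia.
    have /submxP[y ey] : (x <= M (Ordinal lt'))%MS.
      rewrite submxE -trmx_eq0 trmx_mul trmxK colE mulmxA.
      have le : ((cokermx (M (Ordinal lt')))^T <= S)%MS.
        apply: (submx_trans (B := kermx (M (Ordinal lt'))^T)); last exact: (sumsmx_sup (Ordinal lt')).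
        by apply/sub_kermxP; rewrite -trmx_mul mulmx_coker trmx0.
      by move: le; rewrite submxE => /eqP ->; rewrite mul0mx.
    by exists (toT y); rewrite ey LM.
  have := hperp _ Ux; rewrite -[phi]toTK // pairT toVK => e0.
  rewrite mxE -[RHS]e0; apply: eq_bigr => i _; by rewrite !mxE.
rewrite -(toTK _ hphi) eu.
have -> : toT (\sum_(j < p.-1) u j *m kermx (M j)^T) =
    fun w => \sum_(j <- index_enum _) 1 * toT (u j *m kermx (M j)^T) w.
  apply: functional_extensionality => w; rewrite /toT.
  under [RHS]eq_bigr => j _ do rewrite mul1r.
  rewrite exchange_big; apply: eq_bigr => i _; rewrite summxE mulr_suml.
  by apply: eq_bigr.
apply: ideal_sum => j _; apply: (ideal_of_perp_Im (hj j)) => // x hx [g eg].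
have eV : toV (Defs.comp p g) = toV g.
  by apply/rowP => i; rewrite !mxE /Defs.comp swd eqxx.
have eL : x = L j (toT (toV g)).
  rewrite -eV toTK => [|w /negbTE hw]; last by rewrite /Defs.comp hw.
  apply: (@tens_ext _ _ p) => w hw; last first.
    by rewrite hx // /L /tlin braid_op_off // /Defs.comp (negbTE hw); ring.
  rewrite eg /L /tlin /braid_op hw eqxx [Defs.comp p g w]/Defs.comp hw eqxx.
  rewrite (@Rop_ext _ _ _ _ _ (Defs.comp p g)) // => z hz.
  by rewrite /Defs.comp hz hw eqxx.
rewrite eL -LM pairT.
set v := u j *m _; have : v *m (M j)^T = 0 by rewrite /v -mulmxA mulmx_ker mulmx0.
move=> hv; transitivity ((v *m (M j)^T *m (toV g)^T) 0 0); last by rewrite hv mul0mx mxE.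
rewrite -mulmxA -trmx_mul mxE; apply: eq_bigr => i _; by rewrite [_^T _ _]mxE.
Qed.

End Perp.

(** * The two Frobenius forms *)

Section Frobenius.
Variables (K : fieldType) (d : nat) (Rc : 'I_d -> 'I_d -> 'I_d -> 'I_d -> K) (q : K).
Local Notation tens := (tens K d).
Local Notation shuf := (shuf Rc q).
Local Notation Ups := (Ups Rc q).
Local Notation words := (words d).
Local Notation dlt := (dlt K).
Local Notation quad_ideal := (ideal (perp2 Rc q)).
Implicit Types (f g h x : tens) (u v w : seq 'I_d).

Definition words_upto n := flatten [seq words k | k <- iota 0 n.+1].

Lemma sum_words_upto n (F : seq 'I_d -> K) :
  \sum_(i < size (words_upto n)) F (nth [::] (words_upto n) i) =
  \sum_(k < n.+1) \sum_(v <- words k) F v.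
Proof.
rewrite -(big_mkord xpredT (fun i => F (nth [::] (words_upto n) i))) -(big_nth _ xpredT F).
rewrite big_flatten big_map -(big_mkord xpredT (fun k => \sum_(v <- words k) F v)).
by rewrite /index_iota subn0.
Qed.

Lemma homog_comp k f : homog k (Defs.comp k f).
Proof. by move=> w /negbTE h; rewrite /Defs.comp h. Qed.

Lemma comp_tlin k a f b g : Defs.comp k (tlin a f b g) = tlin a (Defs.comp k f) b (Defs.comp k g).
Proof.
apply: functional_extensionality => w; rewrite /Defs.comp /tlin.
by case: ifP => _ //; ring.
Qed.

Lemma fsupp0 : fsupp (@tzero K d). Proof. by exists 0. Qed.

Lemma fsupp_tlin a f b g : fsupp f -> fsupp g -> fsupp (tlin a f b g).
Proof.
move=> [M hM] [N hN]; exists (M + N)%N => w hw; rewrite /tlin hM ?hN; [ring|lia|lia].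
Qed.

Lemma Ups0 p : Ups p (@tzero K d).
Proof.
apply/UpsP; split=> // j hj; have -> : @tzero K d = tlin 0 (@tzero K d) 0 (@tzero K d).
  by apply: functional_extensionality => w; rewrite /tlin /tzero; ring.
exact: Im_zero.
Qed.

Lemma ideal_of_perp_all f : fsupp f -> perp_all Rc q f -> quad_ideal f.
Proof.
move=> [N hN] hf.
have -> : f = fun w => \sum_(p <- iota 0 N) 1 * Defs.comp p f w.
  apply: functional_extensionality => w; have [lt|ge] := ltnP (size w) N.
    rewrite (bigD1_seq (size w)) ?iota_uniq ?mem_iota //= /Defs.comp eqxx mul1r.
    by rewrite big1 ?addr0 // => p np; rewrite eq_sym (negbTE np) mul1r.
  rewrite hN // big_seq big1 // => p; rewrite mem_iota => hp.
  by rewrite /Defs.comp; case: eqP; rewrite ?mulr0 //; lia.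
apply: ideal_sum => p _; apply: (ideal_of_perp_homog (@homog_comp p f)) => x Ux.
rewrite -(hf p x Ux); apply: pairing_eql => w hw; by rewrite /Defs.comp hw eqxx.
Qed.

Hypothesis heckeR : hecke Rc q.

Lemma star_homogl m f g w : homog m f -> (m <= size w)%N -> star Rc q f g w =
  shuf (size w) m (size w - m) 0 (tpr m (size w - m) f (Defs.comp (size w - m) g)) w.
Proof.
move=> hf hm; rewrite starE //; have hm' : (m < (size w).+1)%N by [].
rewrite (bigD1 (Ordinal hm')) //= big1 ?addr0 => [|k nk].
  by rewrite -!tmul_comp [Defs.comp _ (Defs.comp _ _)]comp_homog //; apply: homog_comp.
have hk : (k <= size w)%N by rewrite -ltnS.
have e0 : tpr k (size w - k) f g = tlin 0 (@tzero K d) 0 (@tzero K d).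
  apply: functional_extensionality => z; rewrite /tpr /tlin /tzero; case: eqP => hz; last by ring.
  rewrite hf; first by ring.
  by rewrite size_takel ?hz ?leq_addr.
by rewrite e0 shuf_lin; [rewrite /tlin; ring | lia].
Qed.

Variables (n : nat) (om : tens) (y0 : seq 'I_d).
Hypotheses (Uom : Ups n om) (om0 : om y0 != 0)
  (gen : forall f, Ups n f -> exists c : K, forall w, f w = c * om w)
  (Un1 : zero_sp (Ups n.+1)).

Lemma quad_dual_frobenius : frobenius (@fsupp K d) quad_ideal (@tmul K d).
Proof.
pose e (i : 'I_(size (words_upto n))) := dlt (nth [::] (words_upto n) i).
(* The pairing with [om] sees only the component of degree n of the product; associativity of the
   form is that of [tmul]. *)
pose B a b := pairing n (tmul a b) om.
have Ae i : fsupp (e i) by apply: fsupp_dlt.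
have span f : fsupp f -> exists c, quad_ideal (fun w => f w - \sum_(i < size (words_upto n)) c i * e i w).
  move=> [N hN]; exists (fun i => f (nth [::] (words_upto n) i)).
  have sumE w : \sum_(i < size (words_upto n)) f (nth [::] (words_upto n) i) * e i w =
      if (size w <= n)%N then f w else 0.
    rewrite (sum_words_upto n (fun v => f v * dlt v w)).
    have z k : k != size w -> \sum_(v <- words k) f v * dlt v w = 0.
      move=> nk; rewrite big_seq big1 // => v; rewrite mem_words => /eqP hv.
      by rewrite homog_dlt ?mulr0 // hv eq_sym.
    case: leqP => hw; last by rewrite big1 // => k _; apply: z; have := ltn_ord k; lia.
    have hw' : (size w < n.+1)%N by [].
    rewrite (bigD1 (Ordinal hw')) //= sum_dltr // big1 ?addr0 // => k nk; exact: z.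
  (* The difference has no components of degree at most n, and above n there is no nonzero element
     of Ups to pair with. *)
  apply: ideal_of_perp_all => [|p x Ux].
    by exists (N + n.+1)%N => w hw; rewrite sumE hN ?ifN ?subrr //; lia.
  have [le|gt] := leqP p n; last first.
    by rewrite (Ups_above Un1 gt Ux) /pairing big1 // => w _; rewrite mulr0.
  rewrite /pairing big_seq big1 // => w; rewrite mem_words => /eqP hw.
  by rewrite sumE hw le subrr mul0r.
have Blin a b c (x y : K) : fsupp a -> fsupp b -> fsupp c ->
    B (tlin x a y b) c = x * B a c + y * B b c /\ B c (tlin x a y b) = x * B c a + y * B c b.
  by move=> _ _ _; rewrite /B tmul_linl tmul_linr !pairing_linl.
have BI a b : fsupp a -> fsupp b -> quad_ideal a -> B a b = 0 /\ B b a = 0.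
  move=> _ fb Ia; have [h1 h2] := ideal_tmul Ia fb.
  by split; [apply: (ideal_perp h2) | apply: (ideal_perp h1)].
have nd a : fsupp a -> (forall b, fsupp b -> B a b = 0) -> quad_ideal a.
  move=> fa ha; apply: ideal_of_perp_all => // k x Ux.
  have [le|gt] := leqP k n; last first.
    by rewrite (Ups_above Un1 gt Ux) /pairing big1 // => w _; rewrite mulr0.
  (* Since [x] is a contraction of [om], its pairing with [a] is a combination of the values of
     [B a] on basis tensors. *)
  have [coef hc] := Ups_contraction heckeR Uom om0 gen Un1 le Ux.
  transitivity (\sum_(v <- words (n - k)) coef v * \sum_(y <- words k) a y * om (y ++ v)).
    transitivity (\sum_(y <- words k) \sum_(v <- words (n - k)) coef v * (a y * om (y ++ v))).
      by apply: sum_words_eq => y hy; rewrite hc // mulr_sumr; apply: eq_bigr => v _; ring.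
    by rewrite exchange_big; apply: eq_bigr => v _; rewrite mulr_sumr.
  rewrite big_seq big1 // => v; rewrite mem_words => /eqP hv.
  rewrite (_ : \sum_(y <- words k) _ = B a (dlt v)); first by rewrite ha ?mulr0 //; apply: fsupp_dlt.
  have hk : (k < n.+1)%N by [].
  rewrite /B pairing_tmul (bigD1 (Ordinal hk)) //= [X in _ + X]big1 ?addr0 => [|i ni]; last first.
    rewrite big1 // => u _; rewrite big_seq big1 // => t; rewrite mem_words => /eqP ht.
    rewrite homog_dlt ?mulr0 ?mul0r // ht hv; apply: contraNneq ni => eki.
    by apply/eqP/val_inj => /=; have := ltn_ord i; lia.
  apply: sum_words_eq => y hy; rewrite -(sum_dlt (fun t => a y * om (y ++ t)) hv).
  by apply: eq_bigr => t _; ring.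
have sym := nondeg_sym fsupp0 fsupp_tlin Ae span Blin BI nd.
split; first by exists _, e.
exists B; split=> //.
- by move=> a b c _ _ _; rewrite /B tmulA.
- exact: (nondeg_witness fsupp0 fsupp_tlin Ae span Blin BI nd).
- pose B' a b := B b a.
  have Blin' a b c (x y : K) : fsupp a -> fsupp b -> fsupp c ->
      B' (tlin x a y b) c = x * B' a c + y * B' b c /\ B' c (tlin x a y b) = x * B' c a + y * B' c b.
    by move=> fa fb fc; have [] := Blin a b c x y fa fb fc.
  have BI' a b : fsupp a -> fsupp b -> quad_ideal a -> B' a b = 0 /\ B' b a = 0.
    by move=> fa fb Ia; have [] := BI a b fa fb Ia.
  exact: (nondeg_witness fsupp0 fsupp_tlin Ae span Blin' BI' sym).
Qed.

Lemma A_Ups_tlin a f b g : A_Ups Rc q f -> A_Ups Rc q g -> A_Ups Rc q (tlin a f b g).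
Proof.
move=> [sf Uf] [sg Ug]; split=> [|k]; first exact: fsupp_tlin.
by rewrite comp_tlin; apply: Ups_tlin.
Qed.

Lemma A_Ups_Ups k f : Ups k f -> A_Ups Rc q f.
Proof.
move=> Uf; have [hf _] := Uf; split=> [|j]; first exact: fsupp_homog hf.
have [->|ne] := eqVneq j k; first by rewrite comp_homog.
rewrite (_ : Defs.comp j f = @tzero K d); first exact: Ups0.
apply: functional_extensionality => w; rewrite /Defs.comp; case: eqP => // hw.
by rewrite hf // hw.
Qed.

Lemma Ups_frobenius : frobenius (A_Ups Rc q) (@tnull K d) (star Rc q).
Proof.
(* The contractions of [om] by trailing words; by [Ups_contraction] they span every component. *)
pose E v : tens := fun y => if (size y + size v == n)%N then om (y ++ v) else 0.
pose e (i : 'I_(size (words_upto n))) := E (nth [::] (words_upto n) i).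
have sy0 : size y0 = n := size_top Uom om0.
(* The coordinate along [om] of the top component of the star product, up to the factor [om y0]. *)
pose B a b := star Rc q a b y0.
have A0 : A_Ups Rc q (@tzero K d) by apply: (@A_Ups_Ups 0); apply: Ups0.
have AE v : A_Ups Rc q (E v).
  have [le|gt] := leqP (size v) n.
    apply: (@A_Ups_Ups (n - size v)); rewrite (_ : E v = ctrr v om).
      by apply: Ups_ctrr; rewrite subnK.
    apply: functional_extensionality => y; rewrite /E /ctrr; case: eqP => // hy.
    by case: Uom => -> //; rewrite size_cat; apply/eqP.
  rewrite (_ : E v = @tzero K d) //; apply: functional_extensionality => y.
  by rewrite /E ifN //; lia.
have above f w : A_Ups Rc q f -> (n < size w)%N -> f w = 0.
  move=> [_ Uf] hw; have := congr1 (@^~ w) (Ups_above Un1 hw (Uf (size w))).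
  by rewrite /Defs.comp eqxx.
have span f : A_Ups Rc q f -> exists c, tnull (fun w => f w - \sum_(i < size (words_upto n)) c i * e i w).
  move=> Af; have [_ Uf] := Af.
  have /fin_all_exists[C hC] (k : 'I_n.+1) : exists coef : seq 'I_d -> K, forall y, size y = k ->
      f y = \sum_(v <- words (n - k)) coef v * om (y ++ v).
    have hk : (k <= n)%N by rewrite -ltnS.
    have [coef hc] := Ups_contraction heckeR Uom om0 gen Un1 hk (Uf k).
    by exists coef => y hy; rewrite -hc // /Defs.comp hy eqxx.
  (* The word [v] is used only for the component of degree n - |v|; [inord] turns this degree into
     an index of [C]. *)
  exists (fun i => let v := nth [::] (words_upto n) i in C (inord (n - size v)) v) => w.
  rewrite (sum_words_upto n (fun v => C (inord (n - size v)) v * E v w)).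
  have z k : (size w + k != n)%N -> \sum_(v <- words k) C (inord (n - size v)) v * E v w = 0.
    move=> nk; rewrite big_seq big1 // => v; rewrite mem_words => /eqP hv.
    by rewrite /E hv (negbTE nk) mulr0.
  have [le|gt] := leqP (size w) n; last first.
    by rewrite above // big1 ?subrr // => k _; apply: z; lia.
  have hk : (n - size w < n.+1)%N by lia.
  rewrite (bigD1 (Ordinal hk)) //= [X in _ - (_ + X)]big1 => [|k nk]; last first.
    by apply: z; apply: contraNneq nk => ek; apply/eqP/val_inj => /=; lia.
  have hw : (size w < n.+1)%N by [].
  rewrite (hC (Ordinal hw) w erefl) addr0 /=; apply/eqP; rewrite subr_eq0; apply/eqP.
  apply: sum_words_eq => v hv; rewrite /E hv subnKC // eqxx; congr (C _ _ * _).
  by apply: val_inj; rewrite /= inordK; lia.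
have Blin a b c (x y : K) : A_Ups Rc q a -> A_Ups Rc q b -> A_Ups Rc q c ->
    B (tlin x a y b) c = x * B a c + y * B b c /\ B c (tlin x a y b) = x * B c a + y * B c b.
  by move=> _ _ _; rewrite /B star_linl // star_linr.
have BI a b : A_Ups Rc q a -> A_Ups Rc q b -> tnull a -> B a b = 0 /\ B b a = 0.
  move=> Aa Ab a0; have -> : a = tlin 0 (@tzero K d) 0 (@tzero K d).
    by apply: functional_extensionality => w; rewrite a0 /tlin /tzero; ring.
  have [-> ->] := Blin _ _ _ 0 0 A0 A0 Ab; by split; ring.
(* [star_nondeg] gives nondegeneracy in the right argument, so the one-sided lemmas are applied to
   the opposite form. *)
pose B' a b := B b a.
have Blin' a b c (x y : K) : A_Ups Rc q a -> A_Ups Rc q b -> A_Ups Rc q c ->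
    B' (tlin x a y b) c = x * B' a c + y * B' b c /\ B' c (tlin x a y b) = x * B' c a + y * B' c b.
  by move=> fa fb fc; have [] := Blin a b c x y fa fb fc.
have BI' a b : A_Ups Rc q a -> A_Ups Rc q b -> tnull a -> B' a b = 0 /\ B' b a = 0.
  by move=> fa fb Ia; have [] := BI a b fa fb Ia.
have nd a : A_Ups Rc q a -> (forall b, A_Ups Rc q b -> B' a b = 0) -> tnull a.
  move=> Aa ha w; have [_ Ua] := Aa; have [le|gt] := leqP (size w) n; last exact: above.
  have := @star_nondeg _ _ _ _ heckeR n om y0 Uom om0 gen Un1 (size w) _ le (Ua (size w)).
  have wE : Defs.comp (size w) a w = a w by rewrite /Defs.comp eqxx.
  rewrite -[X in _ -> X]/(_) => h; rewrite -wE h // => b Ub.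
  have [hb _] := Ub; rewrite -(ha b (A_Ups_Ups Ub)) /B' /B.
  have lb : (n - size w <= size y0)%N by rewrite sy0 leq_subr.
  by rewrite (star_homogl a hb lb) sy0 subKn.
have sym := nondeg_sym A0 A_Ups_tlin (fun i => AE _) span Blin' BI' nd.
split; first by exists _, e; split=> // i; apply: AE.
exists B; split=> //.
- by move=> a b c _ _ _; rewrite /B starA.
- exact: (nondeg_witness A0 A_Ups_tlin (fun i => AE _) span Blin BI sym).
- exact: (nondeg_witness A0 A_Ups_tlin (fun i => AE _) span Blin' BI' nd).
Qed.

End Frobenius.

Theorem theorem2p5 (K : fieldType) (d : nat) (q : K)
    (Rc : 'I_d -> 'I_d -> 'I_d -> 'I_d -> K) (n : nat) :
  hecke Rc q -> (0 < n)%N ->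
  ((dim1 (Ups Rc q n) -> zero_sp (Ups Rc q n.+1) ->
     frobenius (A_Ups Rc q) (@tnull K d) (star Rc q) /\
     frobenius (@fsupp K d) (ideal (perp2 Rc q)) (@tmul K d)) /\
   ((1 < d)%N -> dim1 (Ups Rc q n) -> zero_sp (Ups Rc q n.+1))).
Proof.
move=> heckeR n0; split=> [[om [Uom [y0 om0] gen]] Un1|]; last exact: dim1_vanish.
by split; [apply: (Ups_frobenius heckeR Uom om0) | apply: (quad_dual_frobenius heckeR Uom om0)].
Qed.
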